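(* Let $0\le\gamma<1$ and $\alpha=\frac{4}{3+\gamma}$. Let $\Omega\subset\mathbb{R}^n$ be a bounded smooth domain and let $\varphi$ be a nonnegative $W^{2,\infty}(\partial\Omega)$ boundary datum. Then for each $\varepsilon>0$ the problem $$\Delta_\infty u=\mathcal{B}_\varepsilon(u)\,u^{-\gamma}\ \text{ in }\Omega,\qquad u=\varphi\ \text{ on }\partial\Omega$$ has a minimal viscosity solution $u_\varepsilon\in C(\overline\Omega)$. Moreover, the family $\{u_\varepsilon\}_{\varepsilon>0}$ is locally Lipschitz-equicontinuous (for each $\Omega'\Subset\Omega$ there is a constant $L$, independent of $\varepsilon$, such that every $u_\varepsilon$ is locally Lipschitz in $\Omega'$ with $|Du_\varepsilon|\le L$ a.e. in $\Omega'$), and $0\le u_\varepsilon\le\|\varphi\|_{L^\infty}$.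
   Context: $\Delta_\infty u=\sum_{i,j}D_{ij}u\,D_iu\,D_ju$, understood in the viscosity sense. Fix $\delta=\frac12\alpha^{-4/(3+\gamma)}$ and a Lipschitz function $\mathcal{B}:\mathbb{R}\to\mathbb{R}$ with $0\le\mathcal{B}\le1$, $\mathcal{B}(s)=0$ for $s\le\delta/2$ and $\mathcal{B}(s)=1$ for $s\ge\delta$. For $\varepsilon>0$ put $\mathcal{B}_\varepsilon(s)=\mathcal{B}(s/\varepsilon^\alpha)$; the expression $\mathcal{B}_\varepsilon(s)s^{-\gamma}$ is taken to be $0$ for $s\le\frac{\delta}{2}\varepsilon^\alpha$ (including negative $s$). Let $\underline u,\overline u\in C(\overline\Omega)$ be the viscosity solutions of $\Delta_\infty\underline u=(\delta/2)^{-\gamma}\varepsilon^{-\alpha\gamma}$ and $\Delta_\infty\overline u=0$ in $\Omega$ with $\underline u=\overline u=\varphi$ on $\partial\Omega$. ''Minimal viscosity solution'' means that the Perron-type infimum $$u_\varepsilon(x)=\inf\{w(x): w\in C(\overline\Omega)\text{ is a viscosity supersolution of the problem},\ \underline u\le w\le\overline u\text{ in }\overline\Omega\}$$ (viscosity supersolution: $\Delta_\infty w\le\mathcal{B}_\varepsilon(w)w^{-\gamma}$ in the viscosity sense) is a viscosity solution of the problem. *)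

(* Defs.v *)
(* R is an arbitrary realType, and R^d is represented by the row vectors 'rV[R]_d. *)
From HB Require Import structures.
From mathcomp Require Import all_boot all_order all_algebra.
From mathcomp Require Import all_classical all_reals all_analysis.

Set Implicit Arguments.
Unset Strict Implicit.
Unset Printing Implicit Defensive.

Import Order.TTheory GRing.Theory Num.Theory.
Import numFieldNormedType.Exports.

Local Open Scope classical_set_scope.
Local Open Scope ring_scope.

Section Euclidean.
Context {R : realType} {d : nat}.
Implicit Types (x : 'rV[R]_d) (f : 'rV[R]_d -> R) (U : set 'rV[R]_d).

(* The library norm on 'rV[R]_d is the sup norm; it has the same topology,
   bounded sets and Lipschitz functions, but balls and |Du| are Euclidean. *)
Definition enorm x : R := Num.sqrt (\sum_(i < d) x 0 i ^+ 2).

Definition partial (i : 'I_d) f : 'rV[R]_d -> R :=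
  fun x => 'D_(delta_mx 0 i) f x.

Definition grad f x : 'rV[R]_d := \row_(i < d) partial i f x.

(* D_{s_1} ... D_{s_k} f for s = [:: s_1; ...; s_k]. *)
Definition partials (s : seq 'I_d) f : 'rV[R]_d -> R := foldr partial f s.

(* f is of class C^k on U (U is meant to be open). *)
Definition Ck (k : nat) U f : Prop :=
  forall s : seq 'I_d, (size s <= k)%N -> forall x, U x ->
    {for x, continuous (partials s f)} /\
    ((size s < k)%N -> forall i, derivable (partials s f) x (delta_mx 0 i)).

Definition smooth U f : Prop := forall k, Ck k U f.

Definition inf_laplacian f x : R :=
  \sum_(i < d) \sum_(j < d)
    partial i (partial j f) x * partial i f x * partial j f x.

Definition boundary U : set 'rV[R]_d := closure U `\` interior U.

Definition borel_set U : Prop := <<s [set V : set 'rV[R]_d | open V] >> U.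

Definition borel_fun_on U f : Prop :=
  forall V : set R, open V -> borel_set (U `&` f @^-1` V).

End Euclidean.

(* The d-dimensional Lebesgue integral as an iterated one-dimensional integral,
   i.e. the integral against the product measure. It is only applied to Borel
   functions that are nonnegative, or bounded with bounded support, for which
   this is justified by the Tonelli and Fubini theorems. *)
Fixpoint leb_integral {R : realType} (d : nat) :
    ('rV[R]_d -> \bar R) -> \bar R :=
  match d with
  | 0 => fun f => f 0
  | d'.+1 => fun f =>
      (\int[@lebesgue_measure R]_(t in setT)
         leb_integral (fun y : 'rV[R]_d' =>
           f (row_mx (const_mx t : 'rV[R]_1) y)))%E
  end.

Definition leb_null {R : realType} {d : nat} (A : set 'rV[R]_d) : Prop :=
  exists N : set 'rV[R]_d,
    [/\ borel_set N, A `<=` N & leb_integral (fun x => (\1_N x)%:E) = 0%E].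

(* P x holds for Lebesgue-almost every x in A. *)
Definition ae_in {R : realType} {d : nat} (A : set 'rV[R]_d)
    (P : 'rV[R]_d -> Prop) : Prop :=
  leb_null [set x | A x /\ ~ P x].

Section Sobolev.
Context {R : realType} {d : nat}.
Implicit Types (U : set 'rV[R]_d) (f v eta : 'rV[R]_d -> R).

Definition test_fun U eta : Prop :=
  smooth setT eta /\
  exists K : set 'rV[R]_d,
    [/\ compact K, K `<=` U & forall x, ~ K x -> eta x = 0].

(* v = D_{s_1} ... D_{s_k} f in the weak sense on U. *)
Definition weak_partials U (s : seq 'I_d) f v : Prop :=
  forall eta, test_fun U eta ->
    leb_integral (fun x => (f x * partials s eta x)%:E) =
    leb_integral (fun x => ((-1) ^+ size s * (v x * eta x))%:E).

(* f belongs to W^{2,oo}(U): all weak derivatives of order at most 2, including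
   f itself (s = [::]), have a bounded Borel representative. *)
Definition W2inf U f : Prop :=
  borel_fun_on U f /\
  forall s : seq 'I_d, (size s <= 2)%N ->
    exists v, [/\ borel_fun_on U v, exists M : R, forall x, U x -> `|v x| <= M
      & weak_partials U s f v].

End Sobolev.

Section SmoothDomain.
Context {R : realType} {n : nat}.
Implicit Types (Omega : set 'rV[R]_n.+1) (phi : 'rV[R]_n.+1 -> R).

(* The point with first coordinate g y and remaining coordinates y, read in the
   orthonormal frame given by the rows of Q. *)
Definition graph_point (Q : 'M[R]_n.+1) (g : 'rV[R]_n -> R) (y : 'rV[R]_n) :
    'rV[R]_n.+1 :=
  row_mx (const_mx (g y) : 'rV[R]_1) y *m Q.

(* Near x0, in the orthonormal frame Q, Omega is the region strictly above the
   graph of the smooth function g. *)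
Definition boundary_chart Omega (x0 : 'rV[R]_n.+1) (r : R) (Q : 'M[R]_n.+1)
    (g : 'rV[R]_n -> R) : Prop :=
  [/\ 0 < r, Q *m Q^T = 1%:M, smooth setT g
    & forall x, enorm (x - x0) < r ->
        let z : 'rV[R]_(1 + n) := x *m Q^T in
        Omega x <-> g (rsubmx z) < z 0 0].

Definition smooth_boundary Omega : Prop :=
  forall x0, boundary Omega x0 -> exists r Q g, boundary_chart Omega x0 r Q g.

Definition bounded_smooth_domain Omega : Prop :=
  [/\ open Omega, connected Omega, Omega !=set0, bounded_set Omega
    & smooth_boundary Omega].

(* phi belongs to W^{2,oo}(boundary Omega): it is W^{2,oo} in the local graph
   parametrizations of an atlas of the boundary. As phi is prescribed pointwise,
   it is the continuous representative of its class. *)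
Definition W2inf_boundary Omega phi : Prop :=
  {within boundary Omega, continuous phi} /\
  forall x0, boundary Omega x0 ->
    exists r Q g, boundary_chart Omega x0 r Q g /\
      W2inf [set y | enorm (graph_point Q g y - x0) < r]
            (phi \o graph_point Q g).

(* For the continuous phi above, the L^oo norm on the boundary is the sup. *)
Definition boundary_sup_norm Omega phi : R :=
  sup [set `|phi x| | x in boundary Omega].

End SmoothDomain.

Section Viscosity.
Context {R : realType} {d : nat}.
Implicit Types (Omega : set 'rV[R]_d) (F : R -> R) (u w phi : 'rV[R]_d -> R).

(* Viscosity sense of Delta_oo u >= F(u) in Omega. *)
Definition visc_sub Omega F u : Prop :=
  forall (x : 'rV[R]_d) (psi : 'rV[R]_d -> R), Omega x -> Ck 2 Omega psi ->
    (\forall y \near x, u y - psi y <= u x - psi x) ->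
    F (u x) <= inf_laplacian psi x.

(* Viscosity sense of Delta_oo u <= F(u) in Omega. *)
Definition visc_super Omega F u : Prop :=
  forall (x : 'rV[R]_d) (psi : 'rV[R]_d -> R), Omega x -> Ck 2 Omega psi ->
    (\forall y \near x, u x - psi x <= u y - psi y) ->
    inf_laplacian psi x <= F (u x).

(* u in C(closure Omega) is a viscosity solution of Delta_oo u = F(u) in Omega,
   u = phi on the boundary. Only the values of u on closure Omega matter. *)
Definition visc_solution Omega F phi u : Prop :=
  [/\ {within closure Omega, continuous u},
      visc_sub Omega F u, visc_super Omega F u
    & forall x, boundary Omega x -> u x = phi x].

Definition perron_class Omega F (ulow uup : 'rV[R]_d -> R) :
    set ('rV[R]_d -> R) :=
  [set w | [/\ {within closure Omega, continuous w}, visc_super Omega F w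
    & forall x, closure Omega x -> ulow x <= w x <= uup x]].

(* The infimum is taken in the extended reals, so that this equation also says
   that the Perron class is nonempty. *)
Definition minimal_visc_solution Omega F phi ulow uup u : Prop :=
  (forall x, closure Omega x ->
     (u x)%:E = ereal_inf [set (w x)%:E | w in perron_class Omega F ulow uup]) /\
  visc_solution Omega F phi u.

Definition locally_lipschitz_in (A : set 'rV[R]_d) u : Prop :=
  forall x, A x -> exists2 V, nbhs x V & [lipschitz u y | y in V `&` A].

End Viscosity.

Section Problem.
Context {R : realType}.
Implicit Types (gamma eps s : R) (B : R -> R).

Definition alpha gamma : R := 4 / (3 + gamma).

Definition delta gamma : R := 2^-1 * alpha gamma `^ (- (4 / (3 + gamma))).

Definition admissible_B gamma B : Prop :=
  [/\ lipschitz B, forall s, 0 <= B s <= 1,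
      forall s, s <= delta gamma / 2 -> B s = 0
    & forall s, delta gamma <= s -> B s = 1].

(* s |-> B_eps(s) s^(-gamma), with value 0 for s <= (delta/2) eps^alpha. *)
Definition rhs gamma B eps s : R :=
  if s <= delta gamma / 2 * eps `^ alpha gamma then 0
  else B (s / eps `^ alpha gamma) * s `^ (- gamma).

(* (delta/2)^(-gamma) eps^(-alpha gamma). *)
Definition rhs_bound gamma eps : R :=
  (delta gamma / 2) `^ (- gamma) * eps `^ (- (alpha gamma * gamma)).

End Problem.

(* Main.v *)
(* The function u_eps is the Perron infimum. The class is nonempty because
   ulow <= uup, by the Armstrong-Smart proof of comparison for infinity-harmonic
   functions. As the right-hand side is bounded, its members are one-sidedly
   Lipschitz with a common local constant, by comparison with the barriers
   a |y - x| - b |y - x|^2; hence u_eps is continuous, and the usual bump argument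
   makes it a solution. As the right-hand side is nonnegative, u_eps is
   infinity-subharmonic, so comparison with cones and 0 <= u_eps <= sup phi bound
   its Lipschitz constant independently of eps. Differentiability almost
   everywhere is Rademacher's theorem, proved for the iterated Lebesgue integral. *)
Require Import Defs.
From HB Require Import structures.
From mathcomp Require Import all_boot all_order all_algebra.
From mathcomp Require Import all_classical all_reals all_analysis.
From mathcomp Require Import measurable_realfun.
From mathcomp Require Import ring lra.
Set Implicit Arguments.
Unset Strict Implicit.
Unset Printing Implicit Defensive.
Import Order.TTheory GRing.Theory Num.Theory.
Import numFieldNormedType.Exports.

Local Open Scope classical_set_scope.
Local Open Scope ring_scope.

(** * Lipschitz functions of one variable *)

Section OneDim.
Context {R : realType}.
Local Notation mu := (@lebesgue_measure R).

(** The right-hand side need not be nondecreasing in the solution, so no comparison principle is at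
    hand for the problem itself. Comparison is invoked only between [ulow] and [uup], where it
    concerns two infinity-subharmonic functions, [ulow] and [- uup], and local maximum functions
    replace the doubling of variables. Outside the Perron argument, viscosity inequalities are
    tested only with polynomials of degree two in [|y - x0|^2]: they are smooth even at their
    centre, their infinity Laplacian is explicit, and they are closed under negation. The same
    Lipschitz lemma serves twice: with the [eps]-dependent bound of the right-hand side for
    continuity of the infimum, and with the bound 0 for the estimate uniform in [eps]. For
    Rademacher's theorem, null sets are recognised by their sections along lines, and they must be
    Borel. This dictates sets defined by closed conditions, rational slopes and radii [1 / (m + 1)],
    and a passage from partial to total differentiability through density points on lines. *)

Lemma wlength_le_ocitv (g : R -> R) (K : R) (X : set R) :
  0 <= K ->
  (forall x y, x <= y -> g y - g x <= K * (y - x)) -> ocitv X ->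
  (wlength g X <= K%:E * wlength idfun X)%E.
Proof.
move=> K0 hg [[a b] _ <-] /=.
rewrite !wlength_itv /= lte_fin; case: ltP => ab; last by rewrite mule0.
by rewrite -!EFinB -EFinM lee_fin hg // ltW.
Qed.

(** Intervals covering [A] with total length below [e / K] have total [g]-length at most [e]. The
    argument stays with covers, so [A] may be any set. *)
Lemma stieltjes_lipschitz_null (g : cumulative R R) (K : R) (A : set R) :
  0 < K ->
  (forall x y, x <= y -> g y - g x <= K * (y - x)) ->
  mu A = 0%E -> lebesgue_stieltjes_measure g A = 0%E.
Proof.
move=> K0 hg A0; apply/eqP; rewrite eq_le; apply/andP; split; last first.
  exact: mu_ext_ge0 (wlength_ge0 g) _.
apply/lee_addgt0Pr => _ /posnumP[e]; rewrite add0e.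
have : (mu A < (e%:num / K)%:E)%E by rewrite A0 lte_fin divr_gt0.
rewrite /lebesgue_measure /lebesgue_stieltjes_measure /measure_extension.
move=> /ereal_inf_lt[_ [F [mF AF] <-] Flt].
apply: (@le_trans _ _ (\sum_(k <oo) wlength g (F k))%E).
  by apply: ereal_inf_lbound; exists F.
have wF0 i : (0 <= wlength g (F i))%E by exact: wlength_ge0.
have wF0' i : (0 <= wlength (@idfun R) (F i))%E by exact: wlength_ge0.
apply: (@le_trans _ _ (\sum_(k <oo) (K%:E * wlength idfun (F k)))%E).
  apply: lee_nneseries => [i _ _|i _]; first exact: wF0.
  by apply: wlength_le_ocitv hg (mF i); exact: ltW.
rewrite nneseriesZl//.
by rewrite -lee_pdivlMl// -EFinM mulrC; exact: ltW.
Qed.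

(** The Stieltjes measure of [g] on []-N, N]] is finite and dominated by Lebesgue measure, so it has
    a Radon-Nikodym density [h]. Up to a constant [g] is the indefinite integral of [h], which is
    differentiable almost everywhere. *)
Lemma cumulative_lipschitz_derivable (g : cumulative R R) (K : R) (N : R) :
  0 < K ->
  (forall x y, x <= y -> g y - g x <= K * (y - x)) ->
  mu.-negligible [set t | - N < t < N /\ ~ derivable g t 1].
Proof.
move=> K0 hg; have [N0|N0] := leP N 0.
  rewrite (_ : [set _ | _] = set0); first exact: negligible_set0.
  by apply/seteqP; split => // t /= [? _]; lra.
pose D : set R := `]- N, N]%classic.
have lsE a b : a <= b ->
    lebesgue_stieltjes_measure g `]a, b]%classic = (g b - g a)%:E.
  move=> ab; rewrite /lebesgue_stieltjes_measure /measure_extension.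
  rewrite measurable_mu_extE//; last exact: is_ocitv.
  transitivity (wlength g [set` `]a, b]%R]) => //.
  rewrite wlength_itv /= lte_fin; move: ab; rewrite le_eqVlt.
  by move=> /predU1P[->|->]//; rewrite ltxx subrr.
have mD : measurable (D : set (measurableTypeR R)) by exact: measurable_itv.
have foo : (lebesgue_stieltjes_measure g D < +oo)%E.
  by rewrite lsE ?ltry//; lra.
pose nu := charge_of_finite_measure (mfrestr mD foo).
have numu : nu `<< mu.
  apply/null_content_dominatesP => A mA A0.
  rewrite /nu /charge_of_finite_measure /= /mfrestr /mrestr.
  apply: (stieltjes_lipschitz_null K0 hg); apply/eqP.
  by rewrite -measure_le0 -A0 measureIl.
pose h := fine \o Radon_Nikodym nu mu.
have hE : EFin \o h = Radon_Nikodym nu mu.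
  by apply/funext => x /=; rewrite fineK// Radon_Nikodym_fin_num.
have hint : mu.-integrable setT (EFin \o h).
  by rewrite hE; exact: Radon_Nikodym_integrable.
have hloc : locally_integrable setT h.
  by apply: open_integrable_locally => //; exact: openT.
have := @FTC1 R h (BRight (- N)) _ hloc.
move=> /[dup] _ H; have {H} := H (fun y => @integrableS _ (measurableTypeR R) R mu
  setT _ (EFin \o h) measurableT (measurable_itv `]- N, y]) (@subsetT _ _) hint).
apply: negligibleS => t /= [/andP[Nt tN] dg] H; apply: dg.
have [dF _] := H (Nt : (BRight (- N) < BRight t)%O).
pose F y := \int[mu]_(s in `]- N, y]) h s.
have gF y : - N < y < N -> F y + g (- N) = g y.
  move=> /andP[Ny yN]; rewrite /F /Rintegral.
  rewrite -[X in fine (integral _ _ X)]/(EFin \o h) hE.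
  have mI : measurable (`]- N, y]%classic : set (measurableTypeR R)).
    exact: measurable_itv.
  rewrite -(Radon_Nikodym_integral numu mI).
  rewrite /nu /charge_of_finite_measure /= /mfrestr /mrestr setIidl.
    by rewrite lsE ?ltW//= subrK.
  by move=> z /=; rewrite /D /= !in_itv/= => /andP[-> zy]/=; lra.
apply: (@near_eq_derivable _ _ _ (F \+ cst (g (- N)))).
  have : \forall y \near t, - N < y < N.
    near=> y; apply/andP; split; near: y; [exact: lt_nbhsr|exact: lt_nbhsl].
  by apply: filterS => y /gF.
by apply: derivableD; [exact: dF|exact: derivable_cst].
Unshelve. all: by end_near. Qed.

(** Adding [L * x] makes [g] nondecreasing with slopes at most [2 L], so that it generates a
    Stieltjes measure; the line is exhausted by the intervals []-n, n[]. *)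
Lemma lipschitz_ae_derivable (g : R -> R) (L : R) :
  (forall x y, `|g x - g y| <= L * `|x - y|) ->
  mu.-negligible [set t | ~ derivable g t 1].
Proof.
move=> hL.
have L0 : 0 <= L by have := hL 1 0; rewrite subr0 normr1 mulr1; exact: le_trans.
pose G x := g x + L * x.
have ndG : nondecreasing G.
  move=> x y xy; have := hL y x; rewrite (@ger0_norm _ (y - x)) ?subr_ge0//.
  by rewrite ler_norml /G; lra.
have GL x y : x <= y -> G y - G x <= (2 * L + 1) * (y - x).
  move=> xy; have := hL y x; rewrite (@ger0_norm _ (y - x)) ?subr_ge0//.
  by rewrite ler_norml /G; nra.
have cg : continuous g.
  move=> x; apply/(@cvgrPdist_le _ R^o) => e e0; near=> y.
  apply: (le_trans (hL x y)).
  have : `|x - y| <= e / (L + 1).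
    by near: y; apply: cvgr_dist_le; [exact: cvg_id|rewrite divr_gt0//; lra].
  rewrite ler_pdivlMr; last lra.
  by have := normr_ge0 (x - y); nra.
have cG : continuous G.
  by move=> x; apply: cvgD; [exact: cg|apply: cvgM; [exact: cvg_cst|exact: cvg_id]].
pose G' : cumulative R R :=
  HB.pack G (isCumulative.Build R _ R G ndG (right_continuousW cG)).
have K0 : 0 < 2 * L + 1 by lra.
have := @negligible_bigcup _ _ _ mu (fun n : nat => [set t : measurableTypeR R | - n%:R < t < n%:R /\ ~ derivable G t 1])
  (fun n => @cumulative_lipschitz_derivable G' _ n%:R K0 GL).
apply: negligibleS => t /= dg.
have [n tn] : exists n : nat, `|t| < n%:R by exists (Num.bound `|t|); exact: archi_boundP.
exists n; first by [].
split; first by rewrite ltr_norml in tn.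
apply: contra_not dg => dG.
rewrite (_ : g = G - (L *: id)).
  by apply: derivableB => //; exact: derivableZ.
by apply/funext => x; rewrite /G !fctE /= addrK.
Unshelve. all: by end_near. Qed.

(** At a density point [t] of [E], a hole of radius [eps * |s|] around [t + s] would remove a fixed
    fraction of the ball of radius [2 |s|] around [t], which is impossible for small [s]. *)
Lemma closed_ae_nonporous (E : set R) (eps : R) : closed E -> 0 < eps ->
  mu.-negligible [set t | E t /\ ~ exists2 d : R, 0 < d & forall s,
    `|s| <= d -> exists2 s', `|s' - s| <= eps * `|s| & E (t + s')].
Proof.
move=> cE e0.
have mE : measurable (E : set (measurableTypeR R)).
  exact: closed_measurable.
have := lebesgue_density mE; apply: negligibleS => t /= [Et npor] H; apply: npor.
(* With [e1 <= 1] the hole lies inside the ball of radius [2 |s|] and occupies the fraction [e1 / 2]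
   of it; hence the threshold [1 - e1 / 2]. *)
pose e1 := Num.min eps 1.
have e10 : 0 < e1 by rewrite lt_min e0 ltr01.
have e11 : e1 <= 1 by rewrite ge_min lexx orbT.
have e1e : e1 <= eps by rewrite ge_min lexx.
rewrite indicE mem_set//= in H.
have e1lt : ((1 - e1 / 2)%:E < 1%:E :> \bar R)%E by rewrite lte_fin; lra.
have [r0 /= r00 Hr] := H [set y | ((1 - e1 / 2)%:E < y)%E] (open_nbhs_nbhs
  (conj (@open_ereal_gt_ereal _ _) e1lt)).
exists (r0 / 4); first by rewrite divr_gt0.
move=> s sr; have [->|s0] := eqVneq s 0.
  by exists 0; rewrite ?addr0// subrr normr0 mulr0.
have s0' : 0 < `|s| by rewrite normr_gt0.
apply: contrapT => nex.
have r2 : 0 < 2 * `|s| by rewrite mulr_gt0.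
have := Hr (2 * `|s|); rewrite /ball_ /= sub0r normrN gtr0_norm// => /(_ _ r2).
have /[swap]/[apply] : 2 * `|s| < r0 by lra.
apply/negP; rewrite -leNgt -/mu.
have mB : forall c (r : R), measurable (ball c r : set (measurableTypeR R)).
  by move=> c r; exact: measurable_ball.
have sub1 : E `&` ball t (2 * `|s|) `<=` ball t (2 * `|s|) `\` ball (t + s) (e1 * `|s|).
  move=> z [Ez tz]; split => // tsz; apply: nex; exists (z - t).
    move: tsz; rewrite /ball /= => /ltW; rewrite distrC => h.
    by rewrite -addrA -opprD; apply: (le_trans h); rewrite ler_pM2r.
  by rewrite addrC subrK.
have sub2 : ball (t + s) (e1 * `|s|) `<=` ball t (2 * `|s|).
  move=> z; rewrite /ball /= => h.
  rewrite (_ : t - z = (t + s - z) - s); last by rewrite addrAC addrK.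
  by apply: (le_lt_trans (ler_normB _ _)); nra.
rewrite lebesgue_measure_ball ?(ltW r2)// inver mulrn_eq0/= gt_eqF//.
rewrite lee_pdivrMr ?pmulrn_lgt0//.
apply: (@le_trans _ _ (mu (ball t (2 * `|s|) `\` ball (t + s) (e1 * `|s|)))).
  by apply: le_measure; rewrite ?inE//; [exact: measurableI|exact: measurableD].
have -> : mu (ball t (2 * `|s|) `\` ball (t + s)%R (e1 * `|s|)%R) =
    (mu (ball t (2 * `|s|)%R) - mu (ball t (2 * `|s|)%R `&` ball (t + s)%R (e1 * `|s|)%R))%E.
  apply: measureD => //.
  by rewrite [X in (X < _)%E]lebesgue_measure_ball ?ltry// (ltW r2).
rewrite setIidr// !lebesgue_measure_ball ?(ltW r2)//; last by rewrite mulr_ge0 ?ltW.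
by rewrite -EFinB -EFinM lee_fin; nra.
Qed.
End OneDim.

(** * Null sets for the iterated Lebesgue integral *)

Section BorelRow.
Context {R : realType}.

Lemma borel_open d (A : set 'rV[R]_d) : open A -> borel_set A.
Proof. by move=> oA; exact: sub_gen_smallest. Qed.

Lemma borel_setC d (A : set 'rV[R]_d) : borel_set A -> borel_set (~` A).
Proof. by move=> bA; rewrite -setTD; exact: sigma_algebraCD. Qed.

Lemma borel_closed d (A : set 'rV[R]_d) : closed A -> borel_set A.
Proof. by move=> cA; rewrite -(setCK A); apply: borel_setC; apply: borel_open; exact: closed_openC. Qed.

Lemma borel_bigcup d (F : (set 'rV[R]_d)^nat) :
  (forall k, borel_set (F k)) -> borel_set (\bigcup_k F k).
Proof. exact: sigma_algebra_bigcup. Qed.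

Lemma borel_setI d (A B : set 'rV[R]_d) :
  borel_set A -> borel_set B -> borel_set (A `&` B).
Proof.
move=> bA bB; rewrite -(setCK (A `&` B)) setCI; apply: borel_setC.
rewrite -bigcup2E; apply: borel_bigcup => -[|[|k]] /=; try exact: borel_setC.
exact: sigma_algebra0.
Qed.

Lemma borel_preimage d e (h : 'rV[R]_d -> 'rV[R]_e) (A : set 'rV[R]_e) :
  continuous h -> borel_set A -> borel_set (h @^-1` A).
Proof.
move=> ch bA.
suff : borel_set `<=` [set B | borel_set (h @^-1` B)] by exact.
apply: smallest_sub => [|B oB]; last first.
  by rewrite /=; apply: borel_open; apply: open_comp => // x _; exact: ch.
split => /=.
- by rewrite preimage_set0; exact: sigma_algebra0.
- by move=> B bB; rewrite setTD preimage_setC; exact: borel_setC.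
- by move=> F bF; rewrite preimage_bigcup; exact: borel_bigcup.
Qed.

Lemma coord_le_norm d (x : 'rV[R]_d) i : `|x 0 i| <= `|x|.
Proof. by rewrite [leRHS]/Num.Def.normr/= mx_normrE; exact: (@le_bigmax _ _ _ _ (fun p => `|x p.1 p.2|) (0, i)). Qed.

Lemma norm_row_le d (x : 'rV[R]_d) (e : R) : 0 <= e -> (forall i, `|x 0 i| <= e) ->
  `|x| <= e.
Proof.
move=> e0 xe; rewrite /Num.Def.normr/= mx_normrE; apply/bigmax_leP; split=> // -[i j] _ /=.
by rewrite (ord1 i).
Qed.

Definition coord_measurable d (dT : measure_display) (T : measurableType dT)
  (h : T -> 'rV[R]_d) := forall i, measurable_fun setT (fun t => h t 0 i).

(** An open set is the union of the countably many cubes with rational centre and radius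
    [1 / (k + 1)] that it contains, and lying in a cube is a finite conjunction of measurable
    conditions on the coordinates. *)
Lemma coord_measurable_preimage d (dT : measure_display) (T : measurableType dT)
    (h : T -> 'rV[R]_d) (A : set 'rV[R]_d) :
  coord_measurable h -> borel_set A -> measurable (h @^-1` A).
Proof.
move=> mh bA.
suff : @borel_set R d `<=` [set B | measurable (h @^-1` B)] by exact.
apply: smallest_sub => [|B oB /=]; last first.
  pose box (c : 'rV[rat]_d * nat) : set 'rV[R]_d :=
    [set x | forall i, `|ratr (c.1 0 i) - x 0 i| < c.2.+1%:R^-1].
  pose I := [set c | box c `<=` B].
  have -> : h @^-1` B = \bigcup_c (if c \in I then h @^-1` box c else set0).
    apply/seteqP; split => t; last first.
      by move=> [c _]; case: ifPn => // /set_mem; exact.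
    move=> Bt.
    have : nbhs (h t) B by exact: open_nbhs_nbhs.
    rewrite -nbhs_ballE => -[e /= e0 eB].
    have [k ke] : exists k, k.+1%:R^-1 < e / 2.
      have [k _ kP] := near_infty_natSinv_lt (PosNum (divr_gt0 e0 (ltr0n R 2))).
      by exists k; apply: kP => /=.
    have k0 : 0 < k.+1%:R^-1 :> R by rewrite invr_gt0.
    have [r rE] : exists r : R, r = k.+1%:R^-1 by eexists.
    rewrite -rE in ke k0.
    have /choice[q qP] : forall i, exists q : rat, `|ratr q - h t 0 i| < r.
      move=> i.
      have [] := @dense_rat R (ball (h t 0 i) r).
      - by exists (h t 0 i); exact: ballxx.
      - exact: ball_open.
      - by move=> x [bx [q _ qx]]; exists q; rewrite qx distrC.
    have qI : (\row_i q i, k) \in I.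
      apply/mem_set => x bx; apply: eB; rewrite mx_norm_ball /ball_ /=.
      apply: (@le_lt_trans _ _ (2 * r)); last by lra.
      apply: norm_row_le; first by lra.
      move=> i; rewrite !mxE; have := bx i; rewrite -rE; have := qP i; rewrite !mxE/=.
      rewrite !ltr_norml ler_norml => /andP[? ?] /andP[? ?]; apply/andP; split; lra.
    exists (\row_i q i, k) => //=; rewrite qI /= => i; rewrite !mxE -rE; exact: qP.
  apply: countable_bigcupT_measurable; first exact: countableP.
  move=> c; case: ifPn => // _.
  have -> : h @^-1` box c = \bigcap_(i in [set` 'I_d]) [set t | `|ratr (c.1 0 i) - h t 0 i| < c.2.+1%:R^-1].
    by apply/seteqP; split=> [t bt i _|t bt i]; exact: bt.
  apply: fin_bigcap_measurable => // i _.
  rewrite -[X in measurable X]setTI.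
  apply: (@measurable_fun_ltr _ _ _ setT (fun t => `|ratr (c.1 0 i) - h t 0 i|) (cst _)) => //.
  apply: measurableT_comp => //; apply: measurable_funB => //.
split => /=.
- by rewrite preimage_set0.
- by move=> B bB; rewrite setTD preimage_setC; exact: measurableC.
- by move=> F bF; rewrite preimage_bigcup; exact: bigcup_measurable.
Qed.

Lemma coord_measurable_row_mx d (dT : measure_display) (T : measurableType dT)
    (a : T -> R) (h : T -> 'rV[R]_d) :
  measurable_fun setT a -> coord_measurable h ->
  coord_measurable (fun t => row_mx (const_mx (a t) : 'rV_1) (h t) : 'rV_(d.+1)).
Proof.
move=> ma mh i.
under eq_fun do rewrite mxE; case: fintype.split => j; last exact: mh.
by under eq_fun do rewrite mxE.
Qed.

(* Measurability of [g t y] along measurable curves; this avoids putting a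
   product sigma-algebra on [T * 'rV_d]. *)
Definition jointly_measurable d (dT : measure_display) (T : measurableType dT)
    (g : T -> 'rV[R]_d -> \bar R) :=
  forall (dS : measure_display) (S : measurableType dS) (a : S -> T) (h : S -> 'rV[R]_d),
    measurable_fun setT a -> coord_measurable h ->
    measurable_fun setT (fun s => g (a s) (h s)).

(** * Measurability of iterated integrals and Tonelli's theorem *)

Lemma leb_integral_ge0 d (f : 'rV[R]_d -> \bar R) :
  (forall x, 0 <= f x)%E -> (0 <= leb_integral f)%E.
Proof.
elim: d f => [|d IH] f f0 /=; first exact: f0.
by apply: integral_ge0 => t _; apply: IH => y; exact: f0.
Qed.

Lemma jointly_measurable_slice d (dT : measure_display) (T : measurableType dT)
    (g : T -> 'rV[R]_d.+1 -> \bar R) :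
  jointly_measurable g ->
  jointly_measurable (fun (p : T * R) (y : 'rV[R]_d) =>
    g p.1 (row_mx (const_mx p.2 : 'rV_1) y)).
Proof.
move=> mg dS S a h ma mh; apply: mg.
  by apply: measurableT_comp ma.
by apply: coord_measurable_row_mx => //; exact: measurableT_comp ma.
Qed.

(** The parameter space is arbitrary because the induction on [d] moves the outermost integration
    variable into it, replacing [T] by [T * R]. *)
Lemma measurable_leb_integral d (dT : measure_display) (T : measurableType dT)
    (g : T -> 'rV[R]_d -> \bar R) :
  jointly_measurable g -> (forall t y, 0 <= g t y)%E ->
  measurable_fun setT (fun t => leb_integral (g t)).
Proof.
elim: d dT T g => [|d IH] dT T g mg g0 /=.
  apply: (mg _ T id (fun=> 0)); first exact: measurable_id.
  by case.
have mF := IH _ _ _ (jointly_measurable_slice mg) (fun p y => g0 _ _).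
apply: (measurable_fun_fubini_tonelli_F (m2 := @lebesgue_measure R) _ mF).
by move=> p; exact: leb_integral_ge0.
Qed.

(** The outer variable is exchanged with the first coordinate by Tonelli's theorem on the plane, and
    with the remaining ones by induction. *)
Lemma leb_integral_tonelli d (g : R -> 'rV[R]_d -> \bar R) :
  jointly_measurable g -> (forall t y, 0 <= g t y)%E ->
  (\int[@lebesgue_measure R]_(t in setT) leb_integral (g t) =
   leb_integral (fun y => \int[@lebesgue_measure R]_(t in setT) g t y))%E.
Proof.
elim: d g => [//|d IH] g mg g0 /=.
have mF := measurable_leb_integral (jointly_measurable_slice mg) (fun p y => g0 _ _).
rewrite (fubini_tonelli (m1 := @lebesgue_measure R) (m2 := @lebesgue_measure R) _ mF); last first.
  by move=> p; exact: leb_integral_ge0.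
apply: eq_integral => s _; apply: IH => // dS S a h ma mh.
apply: mg => //; apply: coord_measurable_row_mx => //; exact: measurable_cst.
Qed.

Lemma jointly_measurable_indic d (N : set 'rV[R]_d.+1) : borel_set N ->
  jointly_measurable (fun t (y : 'rV[R]_d) =>
    (\1_N (row_mx (const_mx t : 'rV_1) y))%:E).
Proof.
move=> bN dS S a h ma mh; apply/measurable_EFinP.
rewrite (_ : (fun s => _) = \1_((fun s => row_mx (const_mx (a s) : 'rV_1) (h s)) @^-1` N)).
  apply: measurable_indic; apply: coord_measurable_preimage bN.
  exact: coord_measurable_row_mx.
by apply/funext => s; rewrite !indicE.
Qed.

Lemma row_mx_delta0 d (t s : R) (y : 'rV[R]_d) :
  row_mx (const_mx (t + s) : 'rV_1) y =
  (row_mx (const_mx t : 'rV_1) y : 'rV_d.+1) + s *: delta_mx 0 ord0.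
Proof.
apply/rowP => i; rewrite !mxE.
case: splitP => j ij; rewrite ?mxE -[i == _]val_eqE /= ij; last by rewrite mulr0 addr0.
by rewrite (ord1 j) /= mulr1.
Qed.

Lemma row_mx_deltaS d (t s : R) (y : 'rV[R]_d) j :
  row_mx (const_mx t : 'rV_1) (y + s *: delta_mx 0 j) =
  (row_mx (const_mx t : 'rV_1) y : 'rV_d.+1) + s *: delta_mx 0 (lift ord0 j).
Proof.
apply/rowP => i; rewrite !mxE.
case: splitP => k ik; rewrite ?mxE -!val_eqE /= ik.
  by rewrite (ord1 k) /= mulr0 addr0.
by rewrite /bump /= add1n eqSS.
Qed.

Lemma leb_integral0 d : leb_integral (fun _ : 'rV[R]_d => 0%E) = 0%E.
Proof.
by elim: d => [//|d IH] /=; under eq_integral do rewrite IH; exact: integral0.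
Qed.

Lemma borel_slice d (N : set 'rV[R]_d.+1) (t : R) : borel_set N ->
  borel_set [set y : 'rV[R]_d | N (row_mx (const_mx t : 'rV_1) y)].
Proof.
apply: (@borel_preimage _ _ (fun y => row_mx (const_mx t : 'rV_1) y)) => y.
move=> A /nbhs_ballP[e /= e0 eA]; apply/nbhs_ballP; exists e => //= z -[_ yz].
apply: eA; split=> // i j; rewrite !mxE; case: fintype.split => k; last exact: yz.
by rewrite !mxE; exact: ballxx.
Qed.

(** If [j] is the first coordinate, Tonelli's theorem makes it the innermost variable, and the inner
    integral is the measure of a line section. Otherwise the hypothesis is inherited by every
    slice. *)
Lemma leb_integral_line_null d (j : 'I_d) (N : set 'rV[R]_d) : borel_set N ->
  (forall x, @lebesgue_measure R [set s | N (x + s *: delta_mx 0 j)] = 0%E) ->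
  leb_integral (fun x => (\1_N x)%:E) = 0%E.
Proof.
elim: d j N => [|d IH] j N bN; first by case: j.
have [j' ->|->] := unliftP ord0 j => Nj /=; last first.
  rewrite leb_integral_tonelli; last 2 first.
  - exact: jointly_measurable_indic.
  - by move=> t y; rewrite lee_fin.
  rewrite -[RHS](leb_integral0 d); congr leb_integral; apply/funext => y.
  have mI : measurable ([set t | N (row_mx (const_mx t : 'rV_1) y)] : set (measurableTypeR R)).
    apply: (@coord_measurable_preimage _ _ _ (fun t : measurableTypeR R => row_mx (const_mx t : 'rV_1) y : 'rV_d.+1)) bN.
    by apply: coord_measurable_row_mx => // i; exact: measurable_cst.
  transitivity (\int[@lebesgue_measure R]_t (\1_[set t | N (row_mx (const_mx t : 'rV_1) y)] t)%:E)%E.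
    by apply: eq_integral => t _; rewrite !indicE.
  rewrite integral_indic// setIT.
  by rewrite -(Nj (row_mx (const_mx 0 : 'rV_1) y)); congr lebesgue_measure;
    apply/seteqP; split => s /=; rewrite -row_mx_delta0 add0r.
rewrite -[RHS](integral0 (@lebesgue_measure R) setT); apply: eq_integral => t _.
rewrite -(IH j' _ (borel_slice t bN)); last by move=> x; rewrite -(Nj (row_mx (const_mx t : 'rV_1) x));
  congr lebesgue_measure; apply/seteqP; split => s /=; rewrite row_mx_deltaS.
by congr leb_integral; apply/funext => y; rewrite !indicE.
Qed.

(** For almost every [t] the slices at [t] of all the [N k] are null simultaneously, so the
    induction hypothesis applies to these slices. *)
Lemma leb_integral_indic_bigcup d (N : (set 'rV[R]_d)^nat) :
  (forall k, borel_set (N k)) ->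
  (forall k, leb_integral (fun x => (\1_(N k) x)%:E) = 0%E) ->
  leb_integral (fun x => (\1_(\bigcup_k N k) x)%:E) = 0%E.
Proof.
elim: d N => [|d IH] N bN N0 /=.
  have {}N0 k : ~ N k 0.
    by move=> Nk; have := N0 k; rewrite /= indicE mem_set// => /eqP; rewrite onee_eq0.
  by rewrite indicE memNset// => -[k _]; exact: N0.
have mN (M : set 'rV[R]_d.+1) : borel_set M -> measurable_fun setT (fun t =>
    leb_integral (fun y : 'rV[R]_d => (\1_M (row_mx (const_mx t : 'rV_1) y))%:E)).
  move=> bM; apply: measurable_leb_integral; first exact: jointly_measurable_indic.
  by move=> t y; rewrite lee_fin.
have ae0 : forall k, {ae @lebesgue_measure R, forall t, setT t ->
    leb_integral (fun y : 'rV[R]_d => (\1_(N k) (row_mx (const_mx t : 'rV_1) y))%:E) = 0%E}.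
  move=> k; apply/ae_eq_integral_abs => //; first exact: mN.
  rewrite -[RHS](N0 k) /=; apply: eq_integral => t _; rewrite gee0_abs//.
  by apply: leb_integral_ge0 => y; rewrite lee_fin.
rewrite -[RHS](integral0 (@lebesgue_measure R) setT).
apply: ge0_ae_eq_integral => //.
- exact: (mN _ (borel_bigcup bN)).
- by move=> t _; apply: leb_integral_ge0 => y; rewrite lee_fin.
have := ae_foralln ae0; apply: filterS => t Nt _.
rewrite -[RHS](IH (fun k => [set y : 'rV[R]_d | N k (row_mx (const_mx t : 'rV_1) y)])).
- by congr leb_integral; apply/funext => y; rewrite !indicE; congr (_%:R%:E).
- by move=> k; exact: borel_slice.
- by move=> k; rewrite -(Nt k)//; congr leb_integral; apply/funext => y; rewrite !indicE.
Qed.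

(** * The sigma-ideal of null sets *)

Lemma leb_nullS d (A B : set 'rV[R]_d) : A `<=` B -> leb_null B -> leb_null A.
Proof. by move=> AB [N [bN BN N0]]; exists N; split => //; exact: subset_trans BN. Qed.

Lemma leb_null0 d : leb_null (set0 : set 'rV[R]_d).
Proof.
exists set0; split => //; first exact: sigma_algebra0.
by rewrite -[RHS](leb_integral0 d); congr leb_integral; apply/funext => x; rewrite indic0.
Qed.

Lemma leb_null_bigcup d (A : (set 'rV[R]_d)^nat) :
  (forall k, leb_null (A k)) -> leb_null (\bigcup_k A k).
Proof.
move=> /choice[N NA]; exists (\bigcup_k N k); split.
- by apply: borel_bigcup => k; have [] := NA k.
- by apply: subset_bigcup => k _; have [] := NA k.
- by apply: leb_integral_indic_bigcup => k; have [] := NA k.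
Qed.

Lemma borel_bigcup_count d (I : countType) (A : I -> set 'rV[R]_d) :
  (forall k, borel_set (A k)) -> borel_set (\bigcup_k A k).
Proof.
move=> bA.
rewrite (_ : \bigcup_k A k = \bigcup_k (if unpickle k is Some i then A i else set0)).
  apply: borel_bigcup => k; case: unpickle => [i|]; [exact: bA|exact: sigma_algebra0].
apply/seteqP; split => x.
  by move=> [i _ Ai]; exists (pickle i) => //; rewrite pickleK.
by move=> [k _]; case: unpickle => // i Ai; exists i.
Qed.

Lemma leb_null_bigcup_count d (I : countType) (A : I -> set 'rV[R]_d) :
  (forall k, leb_null (A k)) -> leb_null (\bigcup_k A k).
Proof.
move=> A0.
apply: (@leb_nullS _ _ (\bigcup_k (if unpickle k is Some i then A i else set0))).
  by move=> x [i _ Ai]; exists (pickle i) => //; rewrite pickleK.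
by apply: leb_null_bigcup => k; case: unpickle => // *; exact: leb_null0.
Qed.

Lemma leb_nullU d (A B : set 'rV[R]_d) :
  leb_null A -> leb_null B -> leb_null (A `|` B).
Proof.
move=> A0 B0; apply: (@leb_nullS _ _ (\bigcup_b (if b then A else B))).
  by move=> x [Ax|Bx]; [exists true|exists false].
by apply: leb_null_bigcup_count => -[].
Qed.

Lemma leb_null_lines d (j : 'I_d) (N : set 'rV[R]_d) : borel_set N ->
  (forall x, (@lebesgue_measure R).-negligible [set s | N (x + s *: delta_mx 0 j)]) ->
  leb_null N.
Proof.
move=> bN Nj; exists N; split => //; apply: (@leb_integral_line_null _ j) => // x.
apply: measure_negligible (Nj x).
apply: (@coord_measurable_preimage _ _ _ (fun s : measurableTypeR R => x + s *: delta_mx 0 j)) bN => i.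
under eq_fun do rewrite !mxE.
by apply: measurable_funD => //; apply: measurable_funM.
Qed.
End BorelRow.

(** * Rademacher's theorem *)

Section Lip.
Context {R : realType}.

Lemma closed_normP (V : normedModType R) (A : set V) :
  (forall x, (forall e : R, 0 < e -> exists2 y, A y & `|x - y| < e) -> A x) -> closed A.
Proof.
move=> h x clx; apply: h => e e0.
have [y [Ay]] := clx _ (nbhsx_ballx x e e0).
by rewrite -ball_normE => ?; exists y.
Qed.

Definition dotr d (q v : 'rV[R]_d) : R := \sum_i q 0 i * v 0 i.

Lemma dotrDr d (q v w : 'rV[R]_d) : dotr q (v + w) = dotr q v + dotr q w.
Proof.
by rewrite /dotr -big_split /=; apply: eq_bigr => i _; rewrite mxE mulrDr.
Qed.

Lemma dotr_delta d (q : 'rV[R]_d) j t : dotr q (t *: delta_mx 0 j) = q 0 j * t.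
Proof.
rewrite /dotr (bigD1 j)//= big1 ?addr0; first by rewrite !mxE !eqxx mulr1.
by move=> i ij; rewrite !mxE (negbTE ij) andbF !mulr0.
Qed.

Lemma dotr_norm_le d (q v : 'rV[R]_d) (c : R) : (forall i, `|q 0 i| <= c) ->
  `|dotr q v| <= d%:R * c * `|v|.
Proof.
move=> qc; apply: (le_trans (ler_norm_sum _ _ _)).
apply: (@le_trans _ _ (\sum_(i < d) c * `|v|)); last first.
  by rewrite sumr_const card_ord -mulrA mulr_natl.
by apply: ler_sum => i _; rewrite normrM ler_pM// coord_le_norm.
Qed.

Lemma dotrBl d (p q v : 'rV[R]_d) : dotr (p - q) v = dotr p v - dotr q v.
Proof.
by rewrite /dotr -sumrB; apply: eq_bigr => i _; rewrite !mxE mulrBl.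
Qed.

(** The slope [q] may depend on [e]: this is what a countable union over rational slopes delivers.
    Convergence of the slopes is a separate step, [differentiable_approx]. *)
Definition first_order_approx d (f : 'rV[R]_d -> R) (x : 'rV[R]_d) :=
  forall e : R, 0 < e -> exists q : 'rV[R]_d, exists2 dl, 0 < dl & forall v, `|v| <= dl ->
    `|f (x + v) - f x - dotr q v| <= e * `|v|.

Section Rademacher.
Context {d : nat} (f : 'rV[R]_d -> R) (L : R).
Hypothesis fL : forall x y, `|f x - f y| <= L * `|x - y|.

Let L0 (j : 'I_d) : 0 <= L.
Proof.
have := fL (delta_mx 0 j) 0; rewrite subr0.
have : 0 < `|delta_mx 0 j : 'rV[R]_d|.
  rewrite normr_gt0; apply/eqP => /matrixP/(_ 0 j); rewrite !mxE !eqxx.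
  by move/eqP; rewrite oner_eq0.
have := normr_ge0 (f (delta_mx 0 j) - f 0); nra.
Qed.

(** Rational slopes and radii [1 / (m + 1)] leave countably many such sets for given [k] and [c].
    Only the first [k] coordinates of [v] are free. *)
Let good_set (k : nat) (c : R) (q : 'rV[rat]_d) (m : nat) : set 'rV[R]_d := [set x |
  forall v : 'rV[R]_d, (forall i : 'I_d, (k <= i)%N -> v 0 i = 0) ->
    `|v| <= m.+1%:R^-1 ->
    `|f (x + v) - f x - dotr (map_mx ratr q) v| <= c * `|v|].

Let closed_good_set k c q m : closed (good_set k c q m).
Proof.
apply: closed_normP => x xcl v vk vm; apply/ler_addgt0Pr => e e0.
(* Moving the base point from [x] to [y] changes [f (x + v) - f x] by at most [2 L |x - y|]. *)
have LL : 0 < 2 * `|L| + 1 by have := normr_ge0 L; lra.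
have [y yG xy] := xcl (e / (2 * `|L| + 1)) (divr_gt0 e0 LL).
have h1 := yG v vk vm.
have h2 := fL (x + v) (y + v); rewrite opprD addrACA subrr addr0 in h2.
have h3 := fL y x; rewrite distrC [`|y - x|]distrC in h3.
rewrite ltr_pdivlMr// in xy.
have h4 : L * `|x - y| <= `|L| * `|x - y| by rewrite ler_wpM2r// ler_norm.
have := normr_ge0 (x - y).
move: h1 h2 h3; rewrite !ler_norml => /andP[? ?] /andP[? ?] /andP[? ?] ?.
by apply/andP; split; nra.
Qed.

(** On each line in direction [j] this is [closed_ae_nonporous]. The slack [eta] in [Z m] makes
    [Z m] closed, so that the exceptional set is Borel; taking [eta = eps * |t|] afterwards produces
    the factor 2. *)
Let porous_null (G : set 'rV[R]_d) (j : 'I_d) (eps : R) : closed G -> 0 < eps ->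
  exists2 Z : nat -> set 'rV[R]_d, leb_null (G `\` \bigcup_m Z m) &
    forall m x t, Z m x -> `|t| <= m.+1%:R^-1 -> t != 0 ->
      exists2 g, G g & `|x + t *: delta_mx 0 j - g| <= 2 * eps * `|t|.
Proof.
move=> cG e0.
pose Z m : set 'rV[R]_d := [set x | forall t, `|t| <= m.+1%:R^-1 ->
  forall eta, 0 < eta -> exists2 g, G g &
    `|x + t *: delta_mx 0 j - g| <= eps * `|t| + eta].
have cZ m : closed (Z m).
  apply: closed_normP => x xcl t tm eta eta0.
  have eta2 : 0 < eta / 2 by rewrite divr_gt0.
  have [y yZ xy] := xcl _ eta2; have [g Gg yg] := yZ _ tm _ eta2.
  exists g => //.
  rewrite (_ : _ - g = (x - y) + (y + t *: delta_mx 0 j - g)); last first.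
    by rewrite !addrA subrK.
  apply: (le_trans (ler_normD _ _)); lra.
exists Z; last first.
  move=> m x t Zx tm t0; have [|g Gg xg] := Zx t tm (eps * `|t|).
    by rewrite mulr_gt0// normr_gt0.
  by exists g => //; apply: (le_trans xg); lra.
apply: (@leb_null_lines _ _ j).
  rewrite setDE; apply: borel_setI; first exact: borel_closed.
  by apply: borel_setC; apply: borel_bigcup => m; exact: borel_closed.
move=> y; pose E := [set s : R | G (y + s *: delta_mx 0 j)].
have cE : closed E.
  apply: closed_normP => s scl; apply: cG.
  move=> B /nbhs_normP[e /= e1 eB].
  have N0 : 0 < `|delta_mx 0 j : 'rV[R]_d| + 1 by rewrite ltr_pwDr.
  have [s' Es' ss'] := scl _ (divr_gt0 e1 N0).
  exists (y + s' *: delta_mx 0 j); split => //; apply: eB => /=.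
  rewrite opprD addrACA subrr add0r -scalerBl normrZ.
  rewrite ltr_pdivlMr// in ss'; have := normr_ge0 (s - s'); nra.
have := closed_ae_nonporous cE e0; apply: negligibleS => s /= [Gs nZ]; split => //.
move=> [dl dl0 H]; apply: nZ.
have [m md] : exists m, m.+1%:R^-1 <= dl.
  have [k _ kP] := near_infty_natSinv_lt (PosNum dl0).
  by exists k; apply/ltW; apply: kP => /=.
exists m => // t tm eta eta0.
have [s' s't Es'] := H t (le_trans tm md).
exists (y + (s + s') *: delta_mx 0 j) => //.
rewrite (_ : _ - _ = (t - s') *: delta_mx 0 j); last first.
  by apply/rowP => i; rewrite !mxE; ring.
rewrite normrZ.
have : `|delta_mx 0 j : 'rV[R]_d| <= 1.
  by apply: norm_row_le => // i; rewrite mxE normr_nat; case: (_ && _).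
rewrite distrC in s't; have := normr_ge0 (t - s'); have := normr_ge0 (delta_mx 0 j : 'rV[R]_d).
nra.
Qed.

(** Restricted to a line, [f] is Lipschitz and so derivable almost everywhere. The derivative is
    replaced by a rational within [eps / 2], which makes the good set a countable union of closed
    sets. *)
Let partial_null (j : 'I_d) (eps : R) : 0 < eps ->
  exists2 N, leb_null N & forall x, ~ N x -> exists q : rat, exists m : nat,
    forall t, `|t| <= m.+1%:R^-1 ->
      `|f (x + t *: delta_mx 0 j) - f x - ratr q * t| <= eps * `|t|.
Proof.
move=> e0; pose P (c : rat * nat) : set 'rV[R]_d := [set x | forall t, `|t| <= c.2.+1%:R^-1 ->
      `|f (x + t *: delta_mx 0 j) - f x - ratr c.1 * t| <= eps * `|t|].
have cP c : closed (P c).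
  apply: closed_normP => x xcl t tm; apply/ler_addgt0Pr => e e1.
  have LL : 0 < 2 * `|L| + 1 by have := normr_ge0 L; lra.
  have [y yG xy] := xcl (e / (2 * `|L| + 1)) (divr_gt0 e1 LL).
  have h1 := yG t tm.
  have h2 := fL (x + t *: delta_mx 0 j) (y + t *: delta_mx 0 j).
  rewrite opprD addrACA subrr addr0 in h2.
  have h3 := fL y x; rewrite distrC [`|y - x|]distrC in h3.
  rewrite ltr_pdivlMr// in xy.
  have h4 : L * `|x - y| <= `|L| * `|x - y| by rewrite ler_wpM2r// ler_norm.
  have := normr_ge0 (x - y).
  move: h1 h2 h3; rewrite !ler_norml => /andP[? ?] /andP[? ?] /andP[? ?] ?.
  by apply/andP; split; nra.
exists (~` \bigcup_c P c); last first.
  by move=> x /contrapT[[q m] _ Px]; exists q, m.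
apply: (@leb_null_lines _ _ j).
  by apply: borel_setC; apply: borel_bigcup_count => c; exact: borel_closed.
move=> y; pose h (s : R) := f (y + s *: delta_mx 0 j).
have hL s s' : `|h s - h s'| <= L * `|s - s'|.
  apply: (le_trans (fL _ _)); rewrite opprD addrACA subrr add0r -scalerBl normrZ.
  have : `|delta_mx 0 j : 'rV[R]_d| <= 1.
    by apply: norm_row_le => // i; rewrite mxE normr_nat; case: (_ && _).
  have := L0 j; have := normr_ge0 (s - s'); have := normr_ge0 (delta_mx 0 j : 'rV[R]_d).
  move=> ? ? ? ?; rewrite ler_wpM2l//; nra.
have := lipschitz_ae_derivable hL; apply: negligibleS => s /= nP dh; apply: nP.
have e2 : 0 < eps / 2 by rewrite divr_gt0.
have [q ql] : exists q : rat, `|ratr q - 'D_1 h s| < eps / 2.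
  have [] := @dense_rat R (ball ('D_1 h s) (eps / 2)).
  - by exists ('D_1 h s); exact: ballxx.
  - exact: ball_open.
  - by move=> x [bx [q _ qx]]; exists q; rewrite qx distrC.
have := dh => /(@cvgr_dist_lt _ R^o)/(_ _ e2); rewrite near_withinE => -[dl /= dl0 H].
have [m md] : exists m, m.+1%:R^-1 < dl.
  have [k _ kP] := near_infty_natSinv_lt (PosNum dl0).
  by exists k; apply: kP => /=.
exists (q, m) => //= t tm; have [->|t0] := eqVneq t 0.
  by rewrite scale0r addr0 subrr mulr0 subr0 normr0 mulr0.
have := H t; rewrite /= sub0r normrN => /(_ (le_lt_trans tm md) t0).
rewrite /shift /= [t%:A]mulr1 [t + s]addrC.
rewrite (_ : f (y + s *: delta_mx 0 j + t *: delta_mx 0 j) = h (s + t)); last first.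
  by rewrite /h scalerDl addrA.
rewrite -/(h s) => Ht.
have tt : 0 < `|t| by rewrite normr_gt0.
rewrite (_ : _ - _ - _ = t * ((t^-1 *: (h (s + t) - h s) - 'D_1 h s) + ('D_1 h s - ratr q))); last first.
  by rewrite /GRing.scale /=; field.
rewrite normrM mulrC ler_pM2r//.
apply: (le_trans (ler_normD _ _)); rewrite distrC in ql; rewrite distrC in Ht; lra.
Qed.

(* Induction on the number [k] of admitted coordinates of [v]. The set [G] where
   the estimate holds in [k] coordinates is closed, so for almost every [x] in [G]
   the point [x + t e_j] is within [2 eps |t|] of [G]; there the estimate in [k]
   coordinates is combined with the partial derivative along [e_j] at [x]. *)
Let bad_null k (eps : R) : (k <= d)%N -> 0 < eps ->
  leb_null (~` \bigcup_(p : 'rV[rat]_d * nat) good_set k (k%:R * (4 * L + 1) * eps) p.1 p.2).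
Proof.
elim: k => [|k IH] kd e0.
  apply: leb_nullS (@leb_null0 R d).
  move=> x /= []; exists (0, 0%N) => // v v0 _.
  rewrite (_ : v = 0); last by apply/rowP => i; rewrite v0 ?mxE.
  rewrite addr0 subrr sub0r normrN normr0 mulr0.
  by rewrite /dotr big1 ?normr0// => i _; rewrite !mxE mulr0.
pose j := Ordinal kd; have LL := L0 j.
have {}IH := IH (ltnW kd) e0; set c := k%:R * _ * eps in IH.
have [N N0 NP] := partial_null j e0.
pose G (p : 'rV[rat]_d * nat) := good_set k c p.1 p.2.
have cG p : closed (G p) by exact: closed_good_set.
pose ZP p := porous_null j (cG p) e0.
pose Z p := sval (cid2 (ZP p)).
have Z0 p : leb_null (G p `\` \bigcup_m Z p m) by rewrite /Z; case: cid2.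
have ZG p : forall m x t, Z p m x -> `|t| <= m.+1%:R^-1 -> t != 0 ->
      exists2 g, G p g & `|x + t *: delta_mx 0 j - g| <= 2 * eps * `|t|.
  by rewrite /Z; case: cid2.
have := leb_nullU (leb_nullU IH N0) (leb_null_bigcup_count Z0).
apply: leb_nullS => x xbad; apply: contrapT => /not_orP[/not_orP[/contrapT[[q m] _ /= xG] xN] xZ].
apply: xbad.
have [m1 _ xZ1] : (\bigcup_r Z (q, m) r) x.
  by apply: contrapT => nZ; apply: xZ; exists (q, m).
have [q1 [m2 xP]] := NP x xN.
exists (\row_i (if i == j then q1 else q 0 i), (m + m1 + m2)%N) => //= v vk vm.
pose t := v 0 j; pose v' := v - t *: delta_mx 0 j.
have v'k (i : 'I_d) : (k <= i)%N -> v' 0 i = 0.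
  rewrite leq_eqVlt => /predU1P[ki|ki].
    have -> : i = j by apply: val_inj.
    by rewrite !mxE !eqxx mulr1 subrr.
  rewrite !mxE vk// (_ : (i == j) = false) ?mulr0 ?subrr//.
  by apply/negbTE; rewrite -val_eqE /= gtn_eqF.
have vj i : v' 0 i = if i == j then 0 else v 0 i.
  by rewrite !mxE eqxx /=; case: eqVneq => [->|_]; rewrite ?mulr1 ?subrr// mulr0 subr0.
have v'v : `|v'| <= `|v|.
  by apply: norm_row_le => // i; rewrite vj; case: ifP => _; rewrite ?normr0 ?coord_le_norm.
have tv : `|t| <= `|v| by exact: coord_le_norm.
have minv (a b : nat) : (a <= b)%N -> b.+1%:R^-1 <= a.+1%:R^-1 :> R.
  by move=> ab; rewrite lef_pV2 ?posrE// ler_nat.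
have Em := le_trans vm (minv m _ (leq_trans (leq_addr m1 m) (leq_addr m2 _))).
have Em1 := le_trans vm (minv m1 _ (leq_trans (leq_addl m m1) (leq_addr m2 _))).
have Em2 := le_trans vm (minv m2 _ (leq_addl _ m2)).
have vE : v = v' + t *: delta_mx 0 j by rewrite subrK.
have dE : dotr (map_mx ratr (\row_i (if i == j then q1 else q 0 i))) v =
    dotr (map_mx ratr q) v' + ratr q1 * t.
  rewrite {1}vE dotrDr dotr_delta !mxE eqxx; congr (_ + _).
  by apply: eq_bigr => i _; rewrite vj !mxE; case: eqP; rewrite ?mulr0.
have [g Gg xg] : exists2 g, G (q, m) g & `|x + t *: delta_mx 0 j - g| <= 2 * eps * `|t|.
  have [t0|t0] := eqVneq t 0; last exact: (ZG _ _ _ _ xZ1 (le_trans tv Em1) t0).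
  by exists x => //; rewrite t0 scale0r addr0 subrr !normr0 mulr0.
(* Replacing [x + t e_j] by [g] costs [L * (2 eps |t|)] twice, once with and once without the
   increment [v'], and the partial derivative costs [eps |t|]: hence the factor [4 L + 1] per
   coordinate. *)
have h1 := Gg v' v'k (le_trans v'v Em).
have h2 := xP t (le_trans tv Em2).
have h3 := fL (x + v) (g + v').
have h4 := fL g (x + t *: delta_mx 0 j).
rewrite distrC [in leRHS]distrC in h4.
have E3 : x + v - (g + v') = x + t *: delta_mx 0 j - g.
  by rewrite /v'; apply/rowP => i; rewrite !mxE; ring.
rewrite E3 in h3.
rewrite dE mulrSr.
have h5 : L * `|x + t *: delta_mx 0 j - g| <= L * (2 * eps * `|t|) by rewrite ler_wpM2l.
have c0 : 0 <= c by rewrite /c !mulr_ge0 ?(ltW e0)//; lra.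
have h6 : c * `|v'| <= c * `|v| by rewrite ler_wpM2l.
have h7 : (4 * L + 1) * eps * `|t| <= (4 * L + 1) * eps * `|v|.
  by rewrite ler_wpM2l// mulr_ge0 ?(ltW e0)//; lra.
rewrite (_ : (k%:R + 1) * (4 * L + 1) * eps = c + (4 * L + 1) * eps); last by rewrite /c; ring.
rewrite /= in h1; move: h1 h2 h3 h4; rewrite !ler_norml.
move=> /andP[? ?] /andP[? ?] /andP[? ?] /andP[? ?]; apply/andP; split; lra.
Qed.

(** Testing on small multiples of [e_i] shows that slopes valid for tolerances [e] and [e'] differ
    by at most [e + e'] in each coordinate. The supremum of the lower bounds [q_i - e] is therefore
    within [e] of every slope valid for [e], and it gives the differential. *)
Lemma differentiable_approx (x : 'rV[R]_d) : first_order_approx f x -> differentiable f x.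
Proof.
move=> H.
pose valid (e : R) (q : 'rV[R]_d) := 0 < e /\ exists2 dl, 0 < dl &
  forall v, `|v| <= dl -> `|f (x + v) - f x - dotr q v| <= e * `|v|.
have key e q e' q' i : valid e q -> valid e' q' -> q 0 i - e <= q' 0 i + e'.
  move=> [e0 [r r0 hq]] [e'0 [r' r'0 hq']].
  pose s := Num.min r r'; have s0 : 0 < s by rewrite lt_min r0 r'0.
  pose v := s *: delta_mx 0 i : 'rV[R]_d.
  have vs : `|v| <= s.
    rewrite normrZ gtr0_norm// -[leRHS]mulr1 ler_wpM2l ?(ltW s0)//.
    by apply: norm_row_le => // k; rewrite mxE normr_nat; case: (_ && _).
  have := hq v (le_trans vs _); rewrite ge_min lexx => /(_ isT).
  have := hq' v (le_trans vs _); rewrite ge_min lexx orbT => /(_ isT).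
  rewrite !dotr_delta.
  have ev : e * `|v| <= e * s by rewrite ler_wpM2l// ltW.
  have e'v : e' * `|v| <= e' * s by rewrite ler_wpM2l// ltW.
  rewrite !ler_norml => /andP[h1 h2] /andP[h3 h4].
  rewrite -(ler_pM2r s0); lra.
pose A i := [set q.2 0 i - q.1 | q in [set q : R * 'rV[R]_d | valid q.1 q.2]].
pose l : 'rV[R]_d := \row_i sup (A i).
have lq e q i : valid e q -> `|(q - l) 0 i| <= e.
  move=> eq; rewrite !mxE ler_norml; apply/andP; split.
    rewrite lerBrDl addrC -lerBrDl opprK addrC.
    apply: ge_sup; first by exists (q 0 i - e), (e, q).
    by move=> _ [[e' q'] /= v' <-]; rewrite addrC; exact: key.
  rewrite lerBlDl -lerBlDr; apply: ub_le_sup; last by exists (e, q).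
  by exists (q 0 i + e) => _ [[e' q'] /= v' <-]; exact: key.
have lH e : 0 < e -> exists2 dl, 0 < dl & forall v, `|v| <= dl ->
    `|f (x + v) - f x - dotr l v| <= e * `|v|.
  move=> e0; pose e1 := e / (1 + d%:R).
  have D0 : 0 < 1 + d%:R :> R by rewrite ltr_pwDl.
  have e10 : 0 < e1 by rewrite divr_gt0.
  have [q [r r0 hq]] := H e1 e10; exists r => // v vr.
  have vq : valid e1 q by split => //; exists r.
  have := dotr_norm_le v (fun i => lq _ _ i vq); rewrite dotrBl.
  have := hq v vr.
  have -> : e = (1 + d%:R) * e1 by rewrite /e1 mulrCA divff ?mulr1// gt_eqF.
  rewrite !ler_norml => /andP[? ?] /andP[? ?]; apply/andP; split; lra.
have dl_lin : linear (dotr l : 'rV[R]_d -> R).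
  move=> a u v; rewrite dotrDr; congr (_ + _).
  by rewrite /dotr scaler_sumr; apply: eq_bigr => i _; rewrite [X in _ * X]mxE /GRing.scale/= mulrCA.
pose dfl : {linear 'rV[R]_d -> R} :=
  HB.pack (dotr l : 'rV[R]_d -> R) (GRing.isLinear.Build R 'rV[R]_d R *:%R (dotr l) dl_lin).
have ex : exists df : {linear 'rV[R]_d -> R}, continuous df /\
   forall y, f y = f (lim (nbhs x)) + df (y - lim (nbhs x)) +o_(y \near x) (y - lim (nbhs x)).
  exists dfl; split.
    rewrite (_ : (dfl : 'rV[R]_d -> R) = \sum_i (fun v : 'rV[R]_d => l 0 i * v 0 i)); last first.
      by apply/funext => v; rewrite fct_sumE.
    apply: (@big_ind _ (fun g : 'rV[R]_d -> R => continuous g)) => [|g h cg ch|i _] v.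
        exact: (@cst_continuous _ _ (0 : R) v).
      exact: (continuousD (cg v) (ch v)).
    apply: (@continuousM _ _ (cst (l 0 i)) (fun w : 'rV[R]_d => w 0 i)).
      exact: cst_continuous.
    exact: coord_continuous.
  rewrite lim_id; last exact: norm_hausdorff.
  have E : f = (fun y => f x + dfl (y - x)) +o_x (fun y => y - x).
    apply/eqaddoP => e e0; have [r r0 hr] := lH e e0.
    near=> y; rewrite /= !fctE.
    have := hr (y - x); rewrite [x + _]addrC subrK opprD addrA; apply.
    by rewrite distrC; near: y; apply: cvgr_dist_le; [exact: cvg_id|].
  by apply: eqaddoEx => z; exact: (congr1 (@^~ z) E).
apply/diffP; exact: (getPex ex).
Unshelve. all: by end_near. Qed.

Lemma rademacher : leb_null [set x | ~ first_order_approx f x].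
Proof.
(* [K] absorbs the factor [d (4 L + 1)] of [bad_null], so that the tolerance [ep p] yields an error
   of at most [1 / (p + 1)]; the final 1 keeps it positive for [d = 0]. *)
pose K := d%:R * (4 * `|L| + 1) + 1.
have K0 : 0 < K by rewrite ltr_pwDr// mulr_ge0//; have := normr_ge0 L; lra.
pose ep (p : nat) : R := (K * p.+1%:R)^-1.
have ep0 p : 0 < ep p by rewrite invr_gt0 mulr_gt0.
have := leb_null_bigcup (fun p => bad_null (leqnn d) (ep0 p)).
apply: leb_nullS => x /= nd; apply: contrapT => ngood; apply: nd.
move=> e e0.
have [p pe] : exists p, p.+1%:R^-1 < e.
  have [k _ kP] := near_infty_natSinv_lt (PosNum e0).
  by exists k; apply: kP => /=.
have [[q m] _ xG] : (\bigcup_(c : 'rV[rat]_d * nat) good_set d (d%:R * (4 * L + 1) * ep p) c.1 c.2) x.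
  by apply: contrapT => nG; apply: ngood; exists p.
exists (map_mx ratr q), m.+1%:R^-1; first by rewrite invr_gt0.
move=> v vm; apply: (le_trans (xG v _ vm)); first by move=> i; rewrite leqNgt ltn_ord.
rewrite ler_wpM2r//; apply: ltW; apply: le_lt_trans pe.
rewrite /ep invfM mulrA -[leRHS]mul1r ler_wpM2r ?invr_ge0//.
rewrite ler_pdivrMr// mul1r /K.
have := ler_norm L; have : 0 <= d%:R :> R by []; nra.
Qed.
End Rademacher.
End Lip.

(** * Euclidean norm and calculus *)

Section Eucl.
Context {R : realType} {d : nat}.
Implicit Types x y z : 'rV[R]_d.

Definition esq x : R := \sum_(i < d) x 0 i ^+ 2.

Lemma esq_ge0 x : 0 <= esq x.
Proof. by apply: sumr_ge0 => i _; exact: sqr_ge0. Qed.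

Lemma enorm_sqr x : enorm x ^+ 2 = esq x.
Proof. by rewrite /enorm sqr_sqrtr// esq_ge0. Qed.

Lemma enorm_ge0 x : 0 <= enorm x.
Proof. exact: sqrtr_ge0. Qed.

Lemma enorm0 : enorm (0 : 'rV[R]_d) = 0.
Proof. by rewrite /enorm big1 ?sqrtr0// => i _; rewrite mxE expr0n. Qed.

Lemma enorm_eq0 x : enorm x = 0 -> x = 0.
Proof.
move=> x0; have := enorm_sqr x; rewrite x0 expr0n /= => /esym/eqP.
rewrite psumr_eq0; last by move=> i _; exact: sqr_ge0.
move=> /allP h; apply/rowP => i; rewrite mxE.
by have := h i; rewrite mem_index_enum sqrf_eq0 => /(_ isT)/eqP.
Qed.

Lemma enormN x : enorm (- x) = enorm x.
Proof. by rewrite /enorm; congr Num.sqrt; apply: eq_bigr => i _; rewrite mxE sqrrN. Qed.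

Lemma enormB x y : enorm (x - y) = enorm (y - x).
Proof. by rewrite -enormN opprB. Qed.

Lemma enormZ (t : R) x : enorm (t *: x) = `|t| * enorm x.
Proof.
rewrite /enorm -sqrtr_sqr -sqrtrM ?sqr_ge0//; congr Num.sqrt.
by rewrite mulr_sumr; apply: eq_bigr => i _; rewrite mxE exprMn.
Qed.

Lemma enorm_le_sqr x (r : R) : 0 <= r -> (enorm x <= r) = (esq x <= r ^+ 2).
Proof. by move=> r0; rewrite -enorm_sqr ler_pXn2r// nnegrE ?enorm_ge0. Qed.

Lemma cauchy_schwarz x y : dotr x y ^+ 2 <= esq x * esq y.
Proof.
have h (t : R) : 0 <= esq x - 2 * t * dotr x y + t ^+ 2 * esq y.
  rewrite (_ : _ + _ = esq (x - t *: y)); first exact: esq_ge0.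
  rewrite /esq /dotr !mulr_sumr -sumrB -big_split /=; apply: eq_bigr => i _.
  by rewrite !mxE; ring.
have := esq_ge0 y; rewrite le_eqVlt => /predU1P[y0|y0].
  suff -> : dotr x y = 0 by rewrite expr0n -y0 mulr0.
  have -> : y = 0 by apply: enorm_eq0; rewrite /enorm -/(esq y) -y0 sqrtr0.
  by rewrite /dotr big1// => i _; rewrite mxE mulr0.
have := h (dotr x y / esq y); rewrite -(ler_pM2r y0) mul0r.
rewrite (_ : (_ - _ + _) * _ = esq x * esq y - dotr x y ^+ 2); first by rewrite subr_ge0.
by field; rewrite gt_eqF.
Qed.

Lemma dotr_le_enorm x y : dotr x y <= enorm x * enorm y.
Proof.
apply: (le_trans (ler_norm _)).
rewrite -(ler_pXn2r (n:=2))// ?nnegrE ?mulr_ge0 ?enorm_ge0//.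
by rewrite real_normK ?num_real// exprMn !enorm_sqr cauchy_schwarz.
Qed.

Lemma enormD x y : enorm (x + y) <= enorm x + enorm y.
Proof.
rewrite enorm_le_sqr ?addr_ge0 ?enorm_ge0//.
rewrite sqrrD !enorm_sqr (_ : esq (x + y) = esq x + dotr x y *+ 2 + esq y).
  by rewrite lerD2r lerD2l lerMn2r dotr_le_enorm orbT.
rewrite /esq /dotr -sumrMnl -!big_split /=; apply: eq_bigr => i _.
by rewrite mxE; ring.
Qed.

Lemma enorm_triangle x y z : enorm (x - z) <= enorm (x - y) + enorm (y - z).
Proof. by apply: le_trans (enormD _ _); rewrite addrA subrK. Qed.

Lemma norm_le_enorm x : `|x| <= enorm x.
Proof.
apply: norm_row_le; first exact: enorm_ge0.
move=> i; rewrite -(ler_pXn2r (n:=2))// ?nnegrE ?enorm_ge0//.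
rewrite enorm_sqr real_normK ?num_real// /esq (bigD1 i)//= lerDl.
by apply: sumr_ge0 => k _; exact: sqr_ge0.
Qed.

Lemma enorm_le_norm x : enorm x <= d%:R * `|x|.
Proof.
have h : forall e : R, 0 < e -> esq x <= (d%:R * `|x|) ^+ 2.
  move=> e e0.
  apply: (@le_trans _ _ (\sum_(i < d) `|x| ^+ 2)).
    by apply: ler_sum => i _; rewrite -(real_normK (num_real _)) ler_pXn2r ?nnegrE// coord_le_norm.
  rewrite sumr_const card_ord exprMn -[leLHS]mulr_natl ler_wpM2r ?sqr_ge0//.
  by rewrite -natrX ler_nat -mulnn; case: (d) => // k; exact: leq_pmulr.
by rewrite enorm_le_sqr ?mulr_ge0//; exact: (h 1).
Qed.

Lemma enorm_delta (i : 'I_d) : enorm (delta_mx 0 i : 'rV[R]_d) = 1.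
Proof.
rewrite /enorm (bigD1 i)//= big1 ?addr0; first by rewrite mxE !eqxx expr1n sqrtr1.
by move=> k ki; rewrite mxE (negbTE ki) andbF expr0n.
Qed.

Lemma nbhs_enormP x (A : set 'rV[R]_d) :
  nbhs x A <-> exists2 r : R, 0 < r & forall y, enorm (y - x) < r -> A y.
Proof.
split=> [/nbhs_normP[e /= e0 eA]|[r r0 rA]].
  exists e => // y yx; apply: eA => /=; rewrite -normrN opprB.
  exact: le_lt_trans (norm_le_enorm _) yx.
apply/nbhs_ballP; have D0 : 0 < d%:R + 1 :> R by rewrite ltr_wpDl.
exists (r / (d%:R + 1)) => /=; first by rewrite divr_gt0.
move=> y; rewrite mx_norm_ball /ball_ /= ltr_pdivlMr// => xy; apply: rA; rewrite enormB.
apply: le_lt_trans (enorm_le_norm _) _; have := normr_ge0 (x - y); nra.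
Qed.

Lemma enorm_continuous (c : 'rV[R]_d) : continuous (fun x => enorm (x - c)).
Proof.
move=> x A /nbhs_ballP[e /= e0 eA].
apply/nbhs_enormP; exists e => // y yx; apply: eA; rewrite /ball /=.
have h1 := enorm_triangle x y c; have h2 := enorm_triangle y x c.
rewrite enormB in yx; rewrite [enorm (y - x)]enormB in h2.
by rewrite ltr_norml; apply/andP; split; lra.
Qed.

Lemma open_enormP (U : set 'rV[R]_d) : open U -> forall x, U x ->
  exists2 r : R, 0 < r & forall y, enorm (y - x) < r -> U y.
Proof. by move=> oU x Ux; apply/nbhs_enormP; exact: open_nbhs_nbhs. Qed.

Lemma compact_eball (x : 'rV[R]_d) (r : R) : compact [set y | enorm (y - x) <= r].
Proof.
apply: bounded_closed_compact.
  exists (`|x| + r); split; first exact: num_real.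
  move=> M xM y /= yx; rewrite -(subrK x y); apply: (le_trans (ler_normD _ _)).
  have := norm_le_enorm (y - x); lra.
rewrite (_ : [set _ | _] = (fun y => enorm (y - x)) @^-1` [set t | t <= r])//.
by apply: preimage_closed => [y _|]; [exact: enorm_continuous|exact: closed_le].
Qed.
End Eucl.

(** * Calculus for functions of class [C^2] *)

Section Calculus.
Context {R : realType} {d : nat}.
Implicit Types (x y z v : 'rV[R]_d) (f g : 'rV[R]_d -> R) (U : set 'rV[R]_d).
Local Notation "''e_' i" := (delta_mx 0 i : 'rV[R]_d) (at level 8, i at level 2).

Lemma is_derive_coord y v (j : 'I_d) :
  is_derive y v (fun z : 'rV[R]_d => z 0 j) (v 0 j).
Proof.
have H : (fun h : R => h^-1 *: ((h *: v + y) 0 j - y 0 j)) @ 0^' --> v 0 j.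
  apply: cvg_near_cst; near=> h.
  rewrite !mxE addrK /GRing.scale /= mulrA mulVf ?mul1r//.
  by near: h; exact: nbhs_dnbhs_neq.
by apply: DeriveDef; [apply/cvg_ex; exists (v 0 j)|exact: cvg_lim].
Unshelve. all: by end_near. Qed.

Lemma is_derive_line f z e (s : R) : derivable f (z + s *: e) e ->
  is_derive s 1 (fun t : R => f (z + t *: e)) ('D_e f (z + s *: e)).
Proof.
move=> df; have E : (fun h : R => h^-1 *: (((fun t => f (z + t *: e)) \o shift s) (h *: 1) - f (z + s *: e)))
    = (fun h : R => h^-1 *: ((f \o shift (z + s *: e)) (h *: e) - f (z + s *: e))).
  apply/funext => h /=; rewrite /shift /=; congr (_ *: (f _ - _)).
  by rewrite [h%:A]mulr1 scalerDl addrCA.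
apply: DeriveDef; first by rewrite /derivable E.
by rewrite /derive E.
Qed.

Lemma mean_value_line f z e (t : R) :
  (forall s : R, `|s| <= `|t| -> derivable f (z + s *: e) e) ->
  exists2 s : R, `|s| <= `|t| & f (z + t *: e) - f z = t * 'D_e f (z + s *: e).
Proof.
move=> df; pose h (s : R) := f (z + s *: e).
have dh (s : R) : `|s| <= `|t| -> is_derive s 1 h ('D_e f (z + s *: e)).
  by move=> st; apply: is_derive_line; exact: df.
have ch (a b : R) : `|a| <= `|t| -> `|b| <= `|t| -> {within `[a, b], continuous h}.
  move=> ta tb; apply: derivable_within_continuous => s; rewrite in_itv/= => /andP[as_ sb].
  have st : `|s| <= `|t|.
    move: ta tb; rewrite !ler_norml => /andP[? ?] /andP[? ?]; apply/andP; split; lra.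
  by have [] := dh s st.
have t0 : `|0 : R| <= `|t| by rewrite normr0.
have [tp|tn] := leP 0 t.
  have [|s] := @MVT_segment R h (fun s => 'D_e f (z + s *: e)) 0 t tp _ (ch 0 t t0 (lexx _)).
    move=> s; rewrite in_itv/= => /andP[s0 st]; apply: dh.
    by rewrite !ger0_norm// ltW.
  rewrite in_itv/= => /andP[s0 st]; rewrite /h scale0r addr0 subr0 => E.
  exists s; first by rewrite !ger0_norm.
  by rewrite E mulrC.
have [|s] := @MVT_segment R h (fun s => 'D_e f (z + s *: e)) t 0 (ltW tn) _ (ch t 0 (lexx _) t0).
  move=> s; rewrite in_itv/= => /andP[s0 st]; apply: dh.
  by rewrite !ltr0_norm// lerN2 ltW.
rewrite in_itv/= => /andP[s0 st]; rewrite /h scale0r addr0 sub0r => E.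
exists s; first by rewrite (ler0_norm st) (ltr0_norm tn) lerN2.
by rewrite -[LHS]opprB E mulrN opprK mulrC.
Qed.

Lemma C1_differentiable U f y : open U -> U y ->
  (forall z i, U z -> derivable f z 'e_i) ->
  (forall i, {for y, continuous (partial i f)}) -> differentiable f y.
Proof.
move=> oU Uy df cf; apply: differentiable_approx => e e0.
exists (grad f y).
pose e' := e / (d%:R + 1); have D0 : 0 < d%:R + 1 :> R by rewrite ltr_wpDl.
have e'0 : 0 < e' by rewrite divr_gt0.
have [r r0 hr] : exists2 r : R, 0 < r & forall z, enorm (z - y) < r ->
    U z /\ forall i, `|partial i f z - partial i f y| <= e'.
  apply/nbhs_enormP; apply: filterI; first exact: open_nbhs_nbhs.
  apply: (@filter_forall _ _ (fun (i : 'I_d) z => `|partial i f z - partial i f y| <= e') (nbhs y) _) => i.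
  have := cf i => /(@cvgr_dist_le _ R^o)/(_ _ e'0); apply: filterS => z.
  by rewrite distrC.
exists (r / (d%:R + 1) / 2); first by rewrite !divr_gt0.
have clm k : (k <= d)%N -> forall v, (forall i : 'I_d, (k <= i)%N -> v 0 i = 0) ->
    `|v| <= r / (d%:R + 1) / 2 -> `|f (y + v) - f y - dotr (grad f y) v| <= k%:R * e' * `|v|.
  elim: k => [|k IH] kd v vk vr.
    have -> : v = 0 by apply/rowP => i; rewrite vk// mxE.
    by rewrite addr0 subrr /dotr big1 ?subr0 ?normr0 ?mulr0// => i _; rewrite [X in _ * X]mxE mulr0.
  pose j := Ordinal kd; pose t := v 0 j; pose v' := v - t *: 'e_j.
  have vE : v = v' + t *: 'e_j by rewrite subrK.
  have vj i : v' 0 i = if i == j then 0 else v 0 i.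
    by rewrite !mxE eqxx /=; case: eqVneq => [->|_]; rewrite ?mulr1 ?subrr// mulr0 subr0.
  have v'v : `|v'| <= `|v|.
    by apply: norm_row_le => // i; rewrite vj; case: ifP => _; rewrite ?normr0 ?coord_le_norm.
  have tv : `|t| <= `|v| by exact: coord_le_norm.
  have v'k : forall i : 'I_d, (k <= i)%N -> v' 0 i = 0.
    move=> i ki; rewrite vj; case: eqVneq => // ij; apply: vk.
    by move: ki; rewrite leq_eqVlt => /predU1P[ki|//]; case/eqP: ij; exact: val_inj.
  have near_s s : `|s| <= `|t| -> enorm (y + v' + s *: 'e_j - y) < r.
    move=> st; rewrite addrAC [y + v']addrC addrK.
    apply: (@le_lt_trans _ _ (d%:R * `|v|)).
      apply: (le_trans (enorm_le_norm _)); rewrite ler_wpM2l//.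
      apply: norm_row_le => // i; rewrite mxE vj [X in _ + X]mxE mxE eqxx /=.
      case: eqVneq => _; first by rewrite mulr1 add0r (le_trans st).
      by rewrite mulr0 addr0 coord_le_norm.
    apply: (@le_lt_trans _ _ (d%:R * (r / (d%:R + 1) / 2))); first by rewrite ler_wpM2l.
    have rE : r = r / (d%:R + 1) * (d%:R + 1) by rewrite divfK// gt_eqF.
    have c0 : 0 < r / (d%:R + 1) by rewrite divr_gt0.
    rewrite {2}rE; move: (r / (d%:R + 1)) c0 => c c0.
    have : 0 <= d%:R * c by rewrite mulr_ge0// ltW.
    lra.
  have [|s st] := @mean_value_line f (y + v') 'e_j t.
    by move=> s st; apply: df; have [] := hr _ (near_s s st).
  rewrite -addrA -vE => E.
  have [_ /(_ j)] := hr _ (near_s s st); rewrite -addrA => pj.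
  have h1 := IH (ltnW kd) v' v'k (le_trans v'v vr).
  rewrite {2}vE dotrDr dotr_delta [grad f y 0 j]mxE.
  rewrite (_ : _ - _ - _ = (f (y + v') - f y - dotr (grad f y) v') +
    t * (partial j f (y + (v' + s *: 'e_j)) - partial j f y)); last first.
    have E' : t * partial j f (y + (v' + s *: 'e_j)) = f (y + v) - f (y + v').
      by rewrite /partial addrA E.
    by rewrite mulrBr E'; ring.
  apply: (le_trans (ler_normD _ _)); rewrite normrM mulrSr !mulrDl mul1r.
  apply: lerD; first by apply: (le_trans h1); rewrite ler_wpM2l// mulr_ge0// ltW.
  rewrite mulrC; apply: ler_pM => //.
move=> v vr; apply: (le_trans (clm d (leqnn _) v _ vr)).
  by move=> i; rewrite leqNgt ltn_ord.
rewrite ler_wpM2r// /e' mulrA ler_pdivrMr//; nra.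
Qed.

Lemma derive_dotr f y v : differentiable f y -> 'D_v f y = dotr (grad f y) v.
Proof.
move=> df; rewrite deriveE//.
have {1}-> : v = \sum_i v 0 i *: 'e_i.
  by rewrite {1}[v]row_sum_delta; apply: eq_bigr.
rewrite linear_sum; apply: eq_bigr => i _.
by rewrite linearZ /= mxE /partial deriveE// mulrC.
Qed.

Lemma Ck2P U f : Ck 2 U f <-> forall x, U x ->
  [/\ {for x, continuous f}, forall i, derivable f x 'e_i,
    forall i, {for x, continuous (partial i f)},
    forall i j, derivable (partial i f) x 'e_j &
    forall i j, {for x, continuous (partial j (partial i f))}].
Proof.
split=> [cf x Ux|cf].
  split.
  - by have [] := cf [::] isT x Ux.
  - by move=> i; have [_ /(_ isT i)] := cf [::] isT x Ux.
  - by move=> i; have [] := cf [:: i] isT x Ux.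
  - by move=> i j; have [_ /(_ isT j)] := cf [:: i] isT x Ux.
  - by move=> i j; have [] := cf [:: j; i] isT x Ux.
case=> [|i [|j [|k s]]] ss x Ux; have [c1 c2 c3 c4 c5] := cf x Ux; last by [].
- by split; [exact: c1|move=> _ k; exact: c2].
- by split; [exact: c3|move=> _ k; exact: c4].
- split; [exact: (c5 j i)|by move=> h; exfalso; move: h; rewrite /= ltnn].
Qed.

Lemma near_open U x (P : 'rV[R]_d -> Prop) : open U -> U x ->
  (forall y, U y -> P y) -> \forall y \near x, P y.
Proof. by move=> oU Ux h; apply: filterS h _; exact: open_nbhs_nbhs. Qed.

Lemma partialD U f g i x : Ck 2 U f -> Ck 2 U g -> U x ->
  partial i (f \+ g) x = partial i f x + partial i g x.
Proof.
move=> /Ck2P cf /Ck2P cg Ux; rewrite /partial deriveD//.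
  by have [_ df _ _ _] := cf x Ux; exact: df.
by have [_ dg _ _ _] := cg x Ux; exact: dg.
Qed.

Lemma partial2D U f g i j x : open U -> Ck 2 U f -> Ck 2 U g -> U x ->
  partial j (partial i (f \+ g)) x = partial j (partial i f) x + partial j (partial i g) x.
Proof.
move=> oU cf cg Ux; rewrite {1}/partial.
rewrite (@near_eq_derive _ _ _ _ (partial i f \+ partial i g)); last first.
  by apply: (near_open oU Ux) => y Uy /=; exact: partialD cf cg Uy.
move: cf cg => /Ck2P cf /Ck2P cg.
have [_ _ _ df _] := cf x Ux; have [_ _ _ dg _] := cg x Ux.
by rewrite deriveD.
Qed.

Lemma near_continuous f g x : (\forall y \near x, f y = g y) ->
  {for x, continuous g} -> {for x, continuous f}.
Proof.
move=> fg cg; rewrite /continuous_at /prop_for.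
have E : f x = g x := nbhs_singleton fg.
rewrite E => A /cg gA; have := @filterI _ (nbhs x) (nbhs_filter x) _ _ fg gA.
by apply: filterS => y [] /= <-.
Qed.

Lemma Ck2D U f g : open U -> Ck 2 U f -> Ck 2 U g -> Ck 2 U (f \+ g).
Proof.
move=> oU cf cg; apply/Ck2P => x Ux.
have [f1 f2 f3 f4 f5] := (Ck2P U f).1 cf x Ux.
have [g1 g2 g3 g4 g5] := (Ck2P U g).1 cg x Ux.
have pD i : \forall y \near x, partial i (f \+ g) y = (partial i f \+ partial i g) y.
  by apply: (near_open oU Ux) => y Uy /=; exact: partialD cf cg Uy.
split.
- exact: (continuousD f1 g1).
- by move=> i; exact: derivableD.
- move=> i; apply: (near_continuous (pD i)); exact: (continuousD (f3 i) (g3 i)).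
- move=> i j; apply: (@near_eq_derivable _ _ _ (partial i f \+ partial i g)).
    by apply: filterS (pD i) => y ->.
  exact: derivableD.
- move=> i j; apply: (@near_continuous _ (partial j (partial i f) \+ partial j (partial i g))).
    by apply: (near_open oU Ux) => y Uy /=; exact: (partial2D i j oU cf cg).
  exact: (continuousD (f5 i j) (g5 i j)).
Qed.

Lemma inf_laplacian_continuous U f x : Ck 2 U f -> U x ->
  {for x, continuous (inf_laplacian f)}.
Proof.
move=> /Ck2P cf Ux; have [_ _ c1 _ c2] := cf x Ux.
rewrite (_ : inf_laplacian f = \sum_i \sum_j
   (partial i (partial j f) \* partial i f \* partial j f)); last first.
  apply/funext => y; rewrite fct_sumE; apply: eq_bigr => i _.
  by rewrite fct_sumE.
elim/big_ind: _ => [|g h cg ch|i _]; first exact: (@cst_continuous _ _ (0 : R)).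
  exact: (continuousD cg ch).
elim/big_ind: _ => [|g h cg ch|j _]; first exact: (@cst_continuous _ _ (0 : R)).
  exact: (continuousD cg ch).
exact: (continuousM (continuousM (c2 j i) (c1 i)) (c1 j)).
Qed.
End Calculus.

(** * First and second order conditions at a touching point *)

Section SecondOrder.
Context {R : realType} {d : nat}.
Implicit Types (x y z v : 'rV[R]_d) (f g : 'rV[R]_d -> R) (U : set 'rV[R]_d).
Local Notation "''e_' i" := (delta_mx 0 i : 'rV[R]_d) (at level 8, i at level 2).

Lemma Ck2_differentiable U f x : open U -> Ck 2 U f -> U x ->
  differentiable f x /\ forall i, differentiable (partial i f) x.
Proof.
move=> oU /Ck2P cf Ux; split; last move=> i; apply: (C1_differentiable oU Ux).
- by move=> z i Uz; have [_ df _ _ _] := cf z Uz.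
- by have [_ _ c _ _] := cf x Ux.
- by move=> z j Uz; have [_ _ _ df _] := cf z Uz; exact: df.
- by have [_ _ _ _ c] := cf x Ux.
Qed.

Lemma near_line x v (P : 'rV[R]_d -> Prop) :
  (\forall y \near x, P y) -> \forall t \near (0 : R), P (x + t *: v).
Proof.
move=> /nbhs_enormP[r r0 hr]; have N0 : 0 < enorm v + 1.
  by rewrite ltr_wpDl// enorm_ge0.
apply/nbhs_ballP; exists (r / (enorm v + 1)) => /=; first by rewrite divr_gt0.
move=> t; rewrite /ball /= sub0r normrN ltr_pdivlMr// => tr; apply: hr.
rewrite addrAC subrr add0r enormZ; have := normr_ge0 t; nra.
Qed.

Lemma local_max_derive_eq0 f x v :
  (\forall y \near x, f y <= f x) ->
  (\forall y \near x, derivable f y v) -> 'D_v f x = 0.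
Proof.
move=> fmax df; pose h (t : R) := f (x + t *: v).
have [r r0 hr] : exists2 r : R, 0 < r & forall t, `|t| < r ->
    h t <= h 0 /\ derivable f (x + t *: v) v.
  have : \forall t \near (0 : R), f (x + t *: v) <= f x /\ derivable f (x + t *: v) v.
    exact: (near_line v (filterI fmax df)).
  move=> /nbhs_ballP[r /= r0 hr]; exists r => // t tr.
  have := hr t; rewrite /ball /= sub0r normrN /h scale0r addr0; exact.
have dh (t : R) : `|t| < r -> is_derive t 1 h ('D_v f (x + t *: v)).
  by move=> tr; apply: is_derive_line; have [] := hr t tr.
have rr : - r <= r by lra.
have H0 : is_derive (0 : R) 1 h 0.
  apply: (derive1_at_max rr).
  - by move=> t; rewrite in_itv/= -ltr_norml => tr; have [] := dh t tr.
  - by rewrite in_itv/= oppr_lt0 r0.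
  - by move=> t; rewrite in_itv/= -ltr_norml => tr; have [] := hr t tr.
have := dh 0; rewrite normr0 scale0r addr0 => /(_ r0) [_ <-].
by have [_ ->] := H0.
Qed.

(** If [c] were positive, [k] would be positive just to the right of 0 and the mean value theorem
    would give [h (r / 2) > h 0]. Differentiability of [k] at the single point 0 suffices. *)
Lemma local_max_second_derive (h k : R -> R) (c : R) :
  (\forall t \near (0 : R), is_derive (t : R) 1 h (k t)) -> (\forall t \near (0 : R), h t <= h 0) ->
  k 0 = 0 -> is_derive (0 : R) 1 k c -> c <= 0.
Proof.
move=> dh hmax k0 [dk kc]; rewrite leNgt; apply/negP => c0.
have c2 : 0 < c / 2 by rewrite divr_gt0.
have := dk => /(@cvgr_dist_lt _ R^o)/(_ _ c2); rewrite -/('D_1 k 0) kc near_withinE.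
move=> /(filterI dh)/(filterI hmax)/nbhs_ballP[r /= r0 hr].
have {}hr t : `|t| < r -> [/\ h t <= h 0, is_derive t 1 h (k t) &
    t != 0 -> `|c - t^-1 * k t| < c / 2].
  move=> tr; have := hr t; rewrite /ball /= sub0r normrN => /(_ tr)[h1 [h2 h3]].
  split => // t0; have := h3 t0.
  by rewrite /shift /= k0 subr0 addr0 [t%:A]mulr1.
have kpos t : 0 < t < r -> 0 < k t.
  move=> /andP[t0 tr]; have [|_ _] := hr t; first by rewrite gtr0_norm.
  rewrite gt_eqF// => /(_ isT); rewrite ltr_norml => /andP[_ h1].
  have : 0 < t^-1 * k t by lra.
  by rewrite pmulr_rgt0// invr_gt0.
have r2 : 0 < r / 2 by rewrite divr_gt0.
have [||s] := @MVT R h k 0 (r / 2) r2.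
- move=> s; rewrite in_itv/= => /andP[s0 sr].
  by have [] := hr s; first by rewrite gtr0_norm//; lra.
- apply: derivable_within_continuous => s; rewrite in_itv/= => /andP[s0 sr].
  by have [|_ [] //] := hr s; first by rewrite ger0_norm//; lra.
rewrite in_itv/= subr0 => /andP[s0 sr] E.
have [|hle _ _] := hr (r / 2); first by rewrite gtr0_norm//; lra.
have : 0 < k s * (r / 2) by rewrite mulr_gt0// kpos// s0 /=; lra.
lra.
Qed.

Lemma is_derive_mulr (F : R -> R) (t a c : R) : is_derive t 1 F a ->
  is_derive t 1 (fun s => F s * c) (a * c).
Proof.
move=> dF; apply: (is_derive_eq (is_deriveM dF (is_derive_cst c t 1))).
by rewrite scaler0 add0r /GRing.scale /= mulrC.
Qed.

(* At the touching point the gradients agree, say to [p], and the second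
   derivative of the difference in the direction [p] is nonpositive. *)
Lemma touching_inf_laplacian U f g x : open U -> U x -> Ck 2 U f -> Ck 2 U g ->
  (\forall y \near x, f y - g y <= f x - g x) ->
  inf_laplacian f x <= inf_laplacian g x.
Proof.
move=> oU Ux cf cg fg.
have fP := (Ck2P U f).1 cf; have gP := (Ck2P U g).1 cg.
have gradE i : partial i f x = partial i g x.
  apply/eqP; rewrite -subr_eq0; apply/eqP.
  rewrite /partial -deriveB; last 2 first.
  - by have [_ df _ _ _] := fP x Ux; exact: df.
  - by have [_ df _ _ _] := gP x Ux; exact: df.
  apply: local_max_derive_eq0 => //.
  apply: (near_open oU Ux) => y Uy; apply: derivableB.
  - by have [_ df _ _ _] := fP y Uy; exact: df.
  - by have [_ df _ _ _] := gP y Uy; exact: df.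
pose p := grad f x.
have pE : grad g x = p by apply/rowP => i; rewrite !mxE gradE.
pose h (t : R) := f (x + t *: p) - g (x + t *: p).
pose k (t : R) := dotr (grad f (x + t *: p)) p - dotr (grad g (x + t *: p)) p.
have dline (F : 'rV[R]_d -> R) (t : R) : differentiable F (x + t *: p) ->
    is_derive t 1 (fun s : R => F (x + s *: p)) (dotr (grad F (x + t *: p)) p).
  move=> dF; rewrite -derive_dotr//; apply: is_derive_line.
  exact: diff_derivable.
(* When [p] is the gradient of [F] at [x], the infinity Laplacian is the second derivative of [F]
   along [p]. The sums are exchanged, so no symmetry of the Hessian is required. *)
have lapE (F : 'rV[R]_d -> R) : grad F x = p -> inf_laplacian F x = \sum_i dotr (grad (partial i F) x) p * p 0 i.
  move=> Fp; rewrite /inf_laplacian exchange_big /=; apply: eq_bigr => i _.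
  rewrite /dotr mulr_suml; apply: eq_bigr => j _.
  by rewrite [grad _ _ _ _]mxE -Fp !mxE.
rewrite -subr_le0 (lapE f)// (lapE g)// -sumrB.
apply: (@local_max_second_derive h k).
- have nU : \forall t \near (0 : R), U (x + t *: p).
    exact: (near_line p (near_open oU Ux (fun y Uy => Uy))).
  apply: filterS nU => t Ut.
  have [df _] := Ck2_differentiable oU cf Ut; have [dg _] := Ck2_differentiable oU cg Ut.
  exact: (is_deriveB (dline f t df) (dline g t dg)).
- by have := near_line p fg; apply: filterS => t /=; rewrite /h scale0r addr0.
- by rewrite /k scale0r addr0 pE subrr.
- rewrite (_ : k = \sum_i ((fun t => partial i f (x + t *: p) * p 0 i) -
      (fun t => partial i g (x + t *: p) * p 0 i))); last first.
    apply/funext => t; rewrite fct_sumE /k /dotr -sumrB.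
    by apply: eq_bigr => i _; rewrite !mxE.
  apply: is_derive_sum => i.
  have [_ dpf] := Ck2_differentiable oU cf Ux.
  have [_ dpg] := Ck2_differentiable oU cg Ux.
  have Hf := dline (partial i f) 0; rewrite scale0r addr0 in Hf.
  have Hg := dline (partial i g) 0; rewrite scale0r addr0 in Hg.
  have {}Hf := Hf (dpf i); have {}Hg := Hg (dpg i).
  exact: (is_deriveB (is_derive_mulr (p 0 i) Hf) (is_derive_mulr (p 0 i) Hg)).
Qed.
End SecondOrder.

(** * Radial viscosity tests and barriers *)

Section Radial.
Context {R : realType} {d : nat}.
Implicit Types (x y z v : 'rV[R]_d) (f g : 'rV[R]_d -> R) (U : set 'rV[R]_d).
Local Notation "''e_' i" := (delta_mx 0 i : 'rV[R]_d) (at level 8, i at level 2).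

(** A quadratic polynomial in [s = |y - x0|^2]; unlike a cone it is smooth at its vertex, and two
    free coefficients are enough to prescribe first and second radial derivatives at a point away
    from it. *)
Definition rquartic x0 (c0 c1 c2 : R) y : R :=
  c0 + c1 * esq (y - x0) + c2 * esq (y - x0) ^+ 2.

Lemma dotr_e (q : 'rV[R]_d) j : dotr q 'e_j = q 0 j.
Proof. by rewrite -['e_j]scale1r dotr_delta mulr1. Qed.

Lemma is_derive_coordB x0 y v (i : 'I_d) :
  is_derive y v (fun z : 'rV[R]_d => (z - x0) 0 i) (v 0 i).
Proof.
rewrite (_ : (fun z : 'rV[R]_d => _) = (fun z : 'rV[R]_d => z 0 i) - cst (x0 0 i)).
  by apply: (is_derive_eq (is_deriveB (is_derive_coord y v i) (is_derive_cst _ _ _)));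
    rewrite subr0.
by apply/funext => z; rewrite !mxE.
Qed.

Lemma is_derive_esq x0 y v :
  is_derive y v (fun z => esq (z - x0)) (2 * dotr (y - x0) v).
Proof.
rewrite (_ : (fun z => _) = \sum_i ((fun z : 'rV[R]_d => (z - x0) 0 i) * (fun z : 'rV[R]_d => (z - x0) 0 i))); last first.
  by apply/funext => z; rewrite fct_sumE; apply: eq_bigr => i _; rewrite expr2.
have -> : 2 * dotr (y - x0) v = \sum_i (2 * (y - x0) 0 i * v 0 i).
  by rewrite mulr_sumr; apply: eq_bigr => i _; rewrite mulrA.
apply: is_derive_sum => i.
have h := is_derive_coordB x0 y v i.
by apply: (is_derive_eq (is_deriveM h h)); rewrite /GRing.scale /=; ring.
Qed.

Lemma is_derive_rquartic x0 c0 c1 c2 y v : is_derive y v (rquartic x0 c0 c1 c2)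
  ((c1 + 2 * c2 * esq (y - x0)) * (2 * dotr (y - x0) v)).
Proof.
have h := is_derive_esq x0 y v.
rewrite (_ : rquartic _ _ _ _ = cst c0 + c1 *: (fun z => esq (z - x0)) +
   c2 *: ((fun z => esq (z - x0)) * (fun z => esq (z - x0)))); last first.
  by apply/funext => z; rewrite /rquartic expr2.
apply: (is_derive_eq (is_deriveD (is_deriveD (is_derive_cst c0 y v)
  (is_deriveZ c1 h)) (is_deriveZ c2 (is_deriveM h h)))).
by rewrite add0r /GRing.scale /=; ring.
Qed.

Lemma partial_rquartic x0 c0 c1 c2 i : partial i (rquartic x0 c0 c1 c2) =
  fun y => (c1 + 2 * c2 * esq (y - x0)) * (2 * (y - x0) 0 i).
Proof.
apply/funext => y; rewrite /partial.
by have [_ ->] := is_derive_rquartic x0 c0 c1 c2 y 'e_i; rewrite dotr_e.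
Qed.

Lemma is_derive_partial_rquartic x0 c0 c1 c2 i y v :
  is_derive y v (partial i (rquartic x0 c0 c1 c2))
    ((c1 + 2 * c2 * esq (y - x0)) * (2 * v 0 i) +
     2 * c2 * (2 * dotr (y - x0) v) * (2 * (y - x0) 0 i)).
Proof.
rewrite partial_rquartic.
have h := is_derive_esq x0 y v; have h' := is_derive_coordB x0 y v i.
rewrite (_ : (fun y => _) = (cst c1 + (2 * c2) *: (fun z => esq (z - x0))) *
   (2 *: (fun z : 'rV[R]_d => (z - x0) 0 i))); last by apply/funext.
apply: (is_derive_eq (is_deriveM (is_deriveD (is_derive_cst c1 y v)
  (is_deriveZ (2 * c2) h)) (is_deriveZ 2 h'))).
transitivity ((c1 + 2 * c2 * esq (y - x0)) * (2 * v 0 i) +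
  (2 * (y - x0) 0 i) * (0 + 2 * c2 * (2 * dotr (y - x0) v))); first by [].
ring.
Qed.

Lemma partial2_rquartic x0 c0 c1 c2 i j : partial j (partial i (rquartic x0 c0 c1 c2)) =
  fun y => (c1 + 2 * c2 * esq (y - x0)) * (2 * (i == j)%:R) +
     2 * c2 * (2 * (y - x0) 0 j) * (2 * (y - x0) 0 i).
Proof.
apply/funext => y; rewrite {1}/partial.
have [_ ->] := is_derive_partial_rquartic x0 c0 c1 c2 i y 'e_j.
by rewrite dotr_e; have -> : ('e_j : 'rV[R]_d) 0 i = (i == j)%:R by rewrite mxE eqxx.
Qed.

Lemma esq_continuous x0 : continuous (fun y => esq (y - x0)).
Proof.
move=> y; rewrite (_ : (fun y => _) = (fun y => enorm (y - x0)) * (fun y => enorm (y - x0))).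
  exact: (continuousM (@enorm_continuous _ _ x0 y) (@enorm_continuous _ _ x0 y)).
by apply/funext => z; rewrite -enorm_sqr expr2.
Qed.

Lemma coordB_continuous x0 (i : 'I_d) : continuous (fun y : 'rV[R]_d => (y - x0) 0 i).
Proof.
move=> y; rewrite (_ : (fun z : 'rV[R]_d => _) = (fun z : 'rV[R]_d => z 0 i) - cst (x0 0 i)).
  by apply: continuousB; [exact: coord_continuous|exact: cst_continuous].
by apply/funext => z; rewrite !mxE.
Qed.

Lemma Ck2_rquartic U x0 c0 c1 c2 : Ck 2 U (rquartic x0 c0 c1 c2).
Proof.
have ce y := @esq_continuous x0 y; have cc i y := @coordB_continuous x0 i y.
have cC (a : R) y : {for y, continuous (cst a : 'rV[R]_d -> R)} by exact: cst_continuous.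
have cP y : {for y, continuous (fun y => c1 + 2 * c2 * esq (y - x0))}.
  exact: (continuousD (cC c1 y) (continuousM (cC (2 * c2) y) (ce y))).
apply/Ck2P => x _; split.
- exact: (continuousD (continuousD (cC c0 x) (continuousM (cC c1 x) (ce x)))
    (continuousM (cC c2 x) (continuousM (ce x) (ce x)))).
- by move=> i; have [] := is_derive_rquartic x0 c0 c1 c2 x 'e_i.
- move=> i; rewrite partial_rquartic.
  exact: (continuousM (cP x) (continuousM (cC 2 x) (cc i x))).
- by move=> i j; have [] := is_derive_partial_rquartic x0 c0 c1 c2 i x 'e_j.
- move=> i j; rewrite partial2_rquartic.
  exact: (continuousD (continuousM (cP x) (cC _ x)) (continuousM (continuousM (cC (2 * c2) x)
    (continuousM (cC 2 x) (cc j x))) (continuousM (cC 2 x) (cc i x)))).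
Qed.

(** For a function [p(s)] of [s = |w|^2] the gradient is [2 p' w] and the Hessian
    [2 p' I + 4 p'' w w^T], so the infinity Laplacian is [8 s p'^2 (p' + 2 s p'')]. *)
Lemma inf_laplacian_rquartic x0 c0 c1 c2 y : let s := esq (y - x0) in
  inf_laplacian (rquartic x0 c0 c1 c2) y =
  8 * s * (c1 + 2 * c2 * s) ^+ 2 * (c1 + 6 * c2 * s).
Proof.
move=> s; rewrite /inf_laplacian; set w := y - x0; set P := c1 + 2 * c2 * s.
transitivity (\sum_i (8 * P ^+ 2 * (c1 + 6 * c2 * s) * w 0 i ^+ 2)).
  apply: eq_bigr => i _.
  under eq_bigr => j _ do rewrite partial2_rquartic !partial_rquartic -/w -/s -/P.
  rewrite (_ : \sum_j _ = \sum_j ((j == i)%:R * (8 * P ^+ 3 * w 0 i * w 0 j)) +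
      \sum_j (32 * c2 * P ^+ 2 * w 0 i ^+ 2 * w 0 j ^+ 2)); last first.
    by rewrite -big_split /=; apply: eq_bigr => j _; ring.
  rewrite -mulr_sumr -/(esq w) -/s (bigD1 i)//= big1 => [|j ji]; last first.
    by rewrite (negbTE ji) mul0r.
  by rewrite eqxx mul1r addr0 /P; ring.
by rewrite -mulr_sumr -/(esq w) -/s; ring.
Qed.

(** The term [c2 |y - x|^4] has vanishing gradient and Hessian at [x]. It serves to make touching
    strict at no cost. *)
Lemma inf_laplacianD_quartic U f x c0 c2 : open U -> U x -> Ck 2 U f ->
  inf_laplacian (f \+ rquartic x c0 0 c2) x = inf_laplacian f x.
Proof.
move=> oU Ux cf; have cq := @Ck2_rquartic U x c0 0 c2.
have s0 : esq (x - x) = 0 by rewrite subrr /esq big1// => i _; rewrite mxE expr0n.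
rewrite /inf_laplacian; apply: eq_bigr => i _; apply: eq_bigr => j _.
rewrite (partial2D _ _ oU cf cq Ux) !(partialD _ cf cq Ux).
rewrite partial2_rquartic !partial_rquartic s0 subrr !mxE.
by rewrite !mulr0 !addr0 !mul0r !addr0.
Qed.

(** The viscosity inequality [Delta_oo f >= - C] on [U], tested with radial quartics only. A
    supersolution enters through its negative. *)
Definition radial_sub U (C : R) f := forall x0 c0 c1 c2 y, U y ->
  (\forall z \near y, f z - rquartic x0 c0 c1 c2 z <= f y - rquartic x0 c0 c1 c2 y) ->
  let s := esq (y - x0) in
  - C <= 8 * s * (c1 + 2 * c2 * s) ^+ 2 * (c1 + 6 * c2 * s).

Lemma visc_sub_radial U F C f : (forall y, U y -> - C <= F (f y)) ->
  visc_sub U F f -> radial_sub U C f.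
Proof.
move=> FC sf x0 c0 c1 c2 y Uy h /=; rewrite -(inf_laplacian_rquartic x0 c0).
by apply: (le_trans (FC _ Uy)); apply: sf h => //; exact: Ck2_rquartic.
Qed.

(** The infinity Laplacian is odd. Restricting to [V] allows a bound on [F] that holds only in part
    of the domain, such as where the solution is negative. *)
Lemma visc_super_radial U V F C f : V `<=` U -> (forall y, V y -> F (f y) <= C) ->
  visc_super U F f -> radial_sub V C (fun y => - f y).
Proof.
move=> VU FC sf x0 c0 c1 c2 y Vy h /=; have Uy := VU y Vy.
have := sf y (rquartic x0 (- c0) (- c1) (- c2)) Uy (@Ck2_rquartic _ _ _ _ _).
have E z : rquartic x0 (- c0) (- c1) (- c2) z = - rquartic x0 c0 c1 c2 z.
  by rewrite /rquartic; ring.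
rewrite inf_laplacian_rquartic.
have h' : \forall z \near y, f y - rquartic x0 (- c0) (- c1) (- c2) y <=
    f z - rquartic x0 (- c0) (- c1) (- c2) z.
  by apply: filterS h => z; rewrite !E; lra.
move=> /(_ h') h1; have := le_trans h1 (FC _ Vy).
set s := esq _; rewrite lerNl; congr (_ <= _); ring.
Qed.

(* The barrier is [a t - b t^2] with [t = |y - x|]. At a touching point [y0] with
   [|y0 - x| = t0], [t] is replaced by the polynomial
   [t0 + (s - s0) / (2 t0) - (1 - th) (s - s0)^2 / (8 t0^3)] in [s = t^2],
   which lies above [t] near [t0] for every [th > 0]. *)
Lemma radial_barrier U C f x (rho a b : R) : radial_sub U C f ->
  (forall y, enorm (y - x) <= rho -> U y) ->
  {within [set y | enorm (y - x) <= rho], continuous f} ->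
  0 < b -> 2 * b * rho < a -> C < 2 * b * (a - 2 * b * rho) ^+ 2 ->
  (forall y, enorm (y - x) = rho -> f y - f x <= a * rho - b * rho ^+ 2) ->
  forall y, enorm (y - x) <= rho ->
    f y <= f x + a * enorm (y - x) - b * enorm (y - x) ^+ 2.
Proof.
move=> sf BU cf b0 ba Cb bd y yx; rewrite leNgt; apply/negP => fy.
pose E : set 'rV[R]_d := [set y | enorm (y - x) <= rho].
pose G z := f z - (a * enorm (z - x) - b * enorm (z - x) ^+ 2).
have cG : {within E, continuous G}.
  pose H z := a * enorm (z - x) - b * enorm (z - x) ^+ 2.
  have cH : {within E, continuous H}.
    apply: continuous_subspaceT => z.
    have ce := @enorm_continuous _ _ x z.
    have cC (k : R) : {for z, continuous (cst k : 'rV[R]_d -> R)} by exact: cst_continuous.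
    exact: (continuousB (continuousM (cC a) ce) (continuousM (cC b) (continuousM ce ce))).
  have -> : G = f - H by [].
  by move=> z; exact: (continuousB (cf z) (cH z)).
have [y0 /set_mem y0E y0max] := EVT_max_rV (ex_intro _ y yx) (@compact_eball _ _ x rho) cG.
have {}y0max z : enorm (z - x) <= rho -> G z <= G y0 by move=> zE; apply: y0max; exact/mem_set.
(* This strict inequality keeps the maximum point away from the centre, where [G] equals [f x], and,
   with the bound on the sphere, away from the sphere. *)
have y0x : f x < G y0 by apply: lt_le_trans (y0max y yx); rewrite /G; lra.
pose t0 := enorm (y0 - x).
have t00 : 0 < t0.
  rewrite lt_neqAle enorm_ge0 andbT; apply/eqP => /esym /enorm_eq0/eqP.
  rewrite subr_eq0 => /eqP E0; move: y0x; rewrite /G E0 subrr enorm0.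
  by rewrite mulr0 expr0n mulr0 !subr0 ltxx.
have t0r : t0 < rho.
  rewrite lt_neqAle (y0E : t0 <= rho) andbT; apply/eqP => E0.
  have := bd _ E0; move: y0x; rewrite /G -/t0 E0; lra.
have a0 : 0 < a by nra.
pose w := a - 2 * b * t0.
have w0 : 0 < a - 2 * b * rho by lra.
have ww : a - 2 * b * rho <= w by rewrite /w; nra.
have K : C < 2 * b * w ^+ 2.
  apply: (lt_le_trans Cb); rewrite ler_wpM2l//; first by lra.
  by rewrite ler_pXn2r// nnegrE; lra.
have wgt0 : 0 < w by lra.
(* At the touching point the test polynomial has infinity Laplacian [w^2 (a th / t0 - 2 b)]. With
   this [th] the positive term takes at most half of the margin [2 b w^2 - C], which leaves a value
   below [- C]. *)
pose th := Num.min (2^-1) ((2 * b * w ^+ 2 - C) * t0 / (2 * w ^+ 2 * a)).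
have D0 : 0 < 2 * w ^+ 2 * a by rewrite !mulr_gt0// exprn_gt0.
have th0 : 0 < th.
  by rewrite lt_min invr_gt0 ltr0n /= divr_gt0// mulr_gt0// subr_gt0.
have th1 : th <= 2^-1 by rewrite ge_min lexx.
have thK : th * (2 * w ^+ 2 * a) <= (2 * b * w ^+ 2 - C) * t0.
  by rewrite -ler_pdivlMr// ge_min lexx orbT.
(* The second Taylor coefficient of the square root at [t0^2] is [- 1 / (8 t0^3)]. The coefficients
   that follow come from expanding in powers of [s], the term [- b s] included. *)
pose ka := (1 - th) / (8 * t0 ^+ 3).
pose c2 := - (a * ka); pose c1 := a / (2 * t0) + 2 * a * ka * t0 ^+ 2 - b.
pose c0 := a * t0 - a * t0 / 2 - a * ka * t0 ^+ 4.
have qE z : rquartic x c0 c1 c2 z = a * (t0 + (enorm (z - x) ^+ 2 - t0 ^+ 2) / (2 * t0) -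
    ka * (enorm (z - x) ^+ 2 - t0 ^+ 2) ^+ 2) - b * enorm (z - x) ^+ 2.
  rewrite /rquartic -enorm_sqr /c0 /c1 /c2; move: (enorm _) => t.
  by field; rewrite gt_eqF.
(* Divided by [a], the difference is [(t - t0)^2 / (8 t0^3)] times [4 t0^2 - (1 - th) (t + t0)^2];
   the last factor is positive at [t0] and stays nonnegative up to [t0 (1 + th / 2)]. *)
have qge z : enorm (z - x) < t0 * (1 + th / 2) ->
    a * enorm (z - x) - b * enorm (z - x) ^+ 2 <= rquartic x c0 c1 c2 z.
  move=> zt; have := enorm_ge0 (z - x); rewrite qE; move: (enorm _) zt => t tt tge0.
  rewrite lerD2r ler_pM2l// -subr_ge0.
  rewrite (_ : _ - _ = (t - t0) ^+ 2 / (8 * t0 ^+ 3) * (4 * t0 ^+ 2 - (1 - th) * (t + t0) ^+ 2)); last first.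
    by rewrite /ka; field; rewrite gt_eqF.
  rewrite mulr_ge0//; first by rewrite divr_ge0 ?sqr_ge0// mulr_ge0// exprn_ge0// ltW.
  have h1 : (t + t0) ^+ 2 <= (t0 * (2 + th / 2)) ^+ 2.
    by rewrite ler_pXn2r// ?nnegrE; nra.
  have h2 : (1 - th) * (t + t0) ^+ 2 <= (1 - th) * (t0 * (2 + th / 2)) ^+ 2.
    by rewrite ler_wpM2l//; lra.
  have h3 : 0 <= t0 ^+ 2 * (4 - (1 - th) * (2 + th / 2) ^+ 2).
    by rewrite mulr_ge0 ?sqr_ge0//; nra.
  by rewrite exprMn in h2; lra.
have := sf x c0 c1 c2 y0 (BU _ y0E).
have touch : \forall z \near y0, f z - rquartic x c0 c1 c2 z <= f y0 - rquartic x c0 c1 c2 y0.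
  have m0 : 0 < Num.min (rho - t0) (t0 * (th / 2)).
    by rewrite lt_min subr_gt0 t0r /= mulr_gt0// divr_gt0.
  apply/nbhs_enormP; exists (Num.min (rho - t0) (t0 * (th / 2))) => // z.
  rewrite lt_min => /andP[z1 z2]; have z3 := enorm_triangle z y0 x.
  rewrite -/t0 in z3.
  have := y0max z; rewrite /G -/t0 => /(_ _) h.
  have {}h := h (ltac:(lra)); have h4 := qge z (ltac:(lra)).
  have : rquartic x c0 c1 c2 y0 = a * t0 - b * t0 ^+ 2.
    by rewrite qE -/t0 subrr mul0r expr0n /= mulr0 subr0 addr0.
  by move=> ->; lra.
move=> /(_ touch); rewrite /= -enorm_sqr -/t0.
rewrite (_ : 8 * _ * _ * _ = w ^+ 2 * (a * th / t0 - 2 * b)); last first.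
  by rewrite /c1 /c2 /ka /w; field; rewrite gt_eqF.
move=> h; have : (2 * b * w ^+ 2 - C) * t0 <= th * (w ^+ 2 * a).
  rewrite -ler_pdivlMr//; apply: (@le_trans _ _ (w ^+ 2 * (a * th / t0))); last first.
    by rewrite le_eqVlt; apply/orP; left; apply/eqP; field; rewrite gt_eqF.
  lra.
have : 0 < (2 * b * w ^+ 2 - C) * t0 by rewrite mulr_gt0// subr_gt0.
nra.
Qed.

(** The barrier with [b = 1]. In [a], the part [C + 1] gives the strict differential inequality,
    [2 M / rho] covers the oscillation on the sphere, and [3 rho] compensates the quadratic term.
    The order of quantifiers makes [a] common to all functions with these bounds. *)
Lemma radial_sub_lipschitz (C M rho : R) : 0 <= C -> 0 <= M -> 0 < rho ->
  exists2 a : R, 0 < a & forall U f x, radial_sub U C f ->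
    (forall y, enorm (y - x) <= rho -> U y) ->
    {within [set y | enorm (y - x) <= rho], continuous f} ->
    (forall y, enorm (y - x) <= rho -> `|f y| <= M) ->
    forall y, enorm (y - x) <= rho -> f y <= f x + a * enorm (y - x).
Proof.
move=> C0 M0 r0; pose a := 3 * rho + C + 1 + 2 * M / rho.
have Mr : 0 <= 2 * M / rho by rewrite divr_ge0 ?mulr_ge0// ltW.
have MrE : 2 * M / rho * rho = 2 * M by rewrite divfK// gt_eqF.
exists a; first by rewrite /a; lra.
move=> U f x sf BU cf fM y yx.
have ar : 2 * 1 * rho < a by rewrite /a; lra.
have Ca : C < 2 * 1 * (a - 2 * 1 * rho) ^+ 2.
  have : C + 1 <= a - 2 * 1 * rho by rewrite /a; lra.
  nra.
have := radial_barrier sf BU cf ltr01 ar Ca _ yx.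
have bd z : enorm (z - x) = rho -> f z - f x <= a * rho - 1 * rho ^+ 2.
  move=> zx; have := fM z; rewrite zx lexx => /(_ isT).
  have := fM x; rewrite subrr enorm0 (ltW r0) => /(_ isT).
  rewrite !ler_norml => /andP[? ?] /andP[? ?].
  have : 2 * M <= a * rho - rho ^+ 2 by rewrite /a; nra.
  lra.
by move=> /(_ bd); have := sqr_ge0 (enorm (y - x)); lra.
Qed.

(** A cone is itself infinity-harmonic off its vertex, so the strict barrier is used with slope
    raised by [et] and a small [b = et / (4 rho)]; the error is at most [et * rho = e]. *)
Lemma radial_sub_cone U f x (rho m : R) : 0 < rho -> radial_sub U 0 f ->
  (forall y, enorm (y - x) <= rho -> U y) ->
  {within [set y | enorm (y - x) <= rho], continuous f} ->
  (forall y, enorm (y - x) <= rho -> f y <= m) ->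
  forall y, enorm (y - x) <= rho -> f y <= f x + (m - f x) / rho * enorm (y - x).
Proof.
move=> r0 sf BU cf fm y yx; apply/ler_addgt0Pr => e e0.
have mx0 : 0 <= m - f x by rewrite subr_ge0 fm// subrr enorm0 ltW.
pose et := e / rho; have et0 : 0 < et by rewrite divr_gt0.
have etE : et * rho = e by rewrite divfK// gt_eqF.
pose sl := (m - f x) / rho; have sl0 : 0 <= sl by rewrite divr_ge0// ltW.
have slE : sl * rho = m - f x by rewrite divfK// gt_eqF.
pose b := et / (4 * rho); have b0 : 0 < b by rewrite divr_gt0// mulr_gt0.
have bE : b * rho = et / 4 by rewrite /b; field; rewrite gt_eqF.
have h1 : 2 * b * rho < sl + et by rewrite -mulrA bE; lra.
have h2 : 0 < 2 * b * (sl + et - 2 * b * rho) ^+ 2.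
  by apply: mulr_gt0; [lra|rewrite exprn_gt0// subr_gt0].
have := radial_barrier sf BU cf b0 h1 h2 _ yx.
have bd z : enorm (z - x) = rho -> f z - f x <= (sl + et) * rho - b * rho ^+ 2.
  move=> zx; have := fm z; rewrite zx lexx => /(_ isT) fz.
  by rewrite expr2 mulrA bE mulrDl slE; nra.
move=> /(_ bd); have := enorm_ge0 (y - x); rewrite -/sl.
have := sqr_ge0 (enorm (y - x)); nra.
Qed.
End Radial.

(** * Comparison for the infinity Laplacian *)

Section Compactness.
Context {R : realType} {d : nat}.
Implicit Types (x y z : 'rV[R]_d) (K U : set 'rV[R]_d) (g : 'rV[R]_d -> R).

Lemma within_continuous_enorm K g : {within K, continuous g} <->
  forall x, K x -> forall e : R, 0 < e -> exists2 r : R, 0 < r &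
    forall y, K y -> enorm (y - x) < r -> `|g y - g x| < e.
Proof.
split=> [/subspace_continuousP cg x Kx e e0|H].
  have /(@cvgr_dist_lt _ R^o)/(_ _ e0) := cg x Kx.
  rewrite near_withinE => /nbhs_enormP[r r0 hr]; exists r => // y Ky yx.
  by rewrite distrC; exact: hr.
apply/subspace_continuousP => x Kx; apply/(@cvgrPdist_lt _ R^o) => e e0.
rewrite near_withinE; have [r r0 hr] := H x Kx e e0.
by apply/nbhs_enormP; exists r => // y yx Ky; rewrite distrC; exact: hr.
Qed.

Lemma compact_margin K U : compact K -> open U -> K `<=` U ->
  exists2 r : R, 0 < r & forall x y, K x -> enorm (y - x) <= r -> U y.
Proof.
move=> /compact_near_coveringP cK oU KU.
have H : forall x, K x -> \forall x' \near x & r \near 0^'+,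
    forall y, enorm (y - x') <= r -> U y.
  move=> x Kx; have [s s0 hs] := open_enormP oU (KU x Kx).
  exists ([set x' | enorm (x' - x) < s / 2], [set r | r < s / 2]).
    split; first by apply/nbhs_enormP; exists (s / 2) => //; rewrite divr_gt0.
    by apply: nbhs_right_lt; rewrite divr_gt0.
  move=> [x' r] /= [x'x rs] y yx'; apply: hs.
  by have := enorm_triangle y x' x; lra.
have [r /= r0 hr] := cK R (0^'+) (fun r x => forall y, enorm (y - x) <= r -> U y) _ H; exists (r / 2); first by rewrite divr_gt0.
move=> x y Kx; have := hr (r / 2); rewrite /ball_ /= sub0r normrN gtr0_norm ?divr_gt0//.
by move=> /(_ ltac:(lra) ltac:(lra)) h; exact: h.
Qed.

Lemma compact_superlevel K g (c : R) : compact K -> {within K, continuous g} ->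
  compact [set x | K x /\ c <= g x].
Proof.
move=> cK /within_continuous_enorm cg.
have clK : closed K by apply: compact_closed cK; exact: norm_hausdorff.
apply: (subclosed_compact _ cK); last by move=> x [].
apply: closed_normP => x xcl.
have xcl' (r : R) : 0 < r -> exists2 y, (K y /\ c <= g y) & enorm (y - x) < r.
  move=> r0; have D0 : 0 < d%:R + 1 :> R by rewrite ltr_wpDl.
  have [y Sy xy] := xcl _ (divr_gt0 r0 D0); exists y => //.
  rewrite ltr_pdivlMr// in xy; rewrite enormB.
  apply: le_lt_trans (enorm_le_norm _) _; have := normr_ge0 (x - y); nra.
have Kx : K x.
  apply: clK => A /nbhs_enormP[r r0 rA]; have [y [Ky _] yx] := xcl' r r0.
  by exists y; split => //; exact: rA.
split => //; apply/ler_addgt0Pr => e e0; have [r r0 hr] := cg x Kx e e0.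
have [y [Ky cy] yx] := xcl' r r0.
have := hr y Ky yx; rewrite ltr_norml => /andP[_ ?]; lra.
Qed.

Lemma bounded_closure_compact U : bounded_set U -> compact (closure U).
Proof.
move=> [M [_ bM]]; apply: bounded_closed_compact; last exact: closed_closure.
exists (M + 1); split; first exact: num_real.
move=> N MN x clx /=; apply/ler_addgt0Pr => e e0.
have [y [Uy]] := clx _ (nbhsx_ballx x e e0).
rewrite -ball_normE /= => xy; have := bM (M + 1) ltac:(lra) y Uy => /= yM.
by rewrite -(subrK y x); apply: (le_trans (ler_normD _ _)); lra.
Qed.

Lemma compact_bounded_fun K g : compact K -> {within K, continuous g} ->
  exists2 M : R, 0 <= M & forall x, K x -> `|g x| <= M.
Proof.
move=> cK cg; have [[x0 Kx0]|K0] := pselect (K !=set0); last first.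
  by exists 0 => // x Kx; case: K0; exists x.
have [c1 _ h1] := EVT_max_rV (ex_intro _ x0 Kx0) cK cg.
have [c2 _ h2] := EVT_min_rV (ex_intro _ x0 Kx0) cK cg.
exists (`|g c1| + `|g c2|); first by rewrite addr_ge0.
move=> x Kx; have := h1 x (mem_set Kx); have := h2 x (mem_set Kx).
have := ler_norm (g c1); have := ler_norm (- g c2); rewrite normrN.
by rewrite ler_norml => *; apply/andP; split; have := normr_ge0 (g c1);
  have := normr_ge0 (g c2); lra.
Qed.

Lemma within_sub K E g : E `<=` K -> {within K, continuous g} -> {within E, continuous g}.
Proof.
move=> EK /within_continuous_enorm cg; apply/within_continuous_enorm => x Ex e e0.
have [r r0 hr] := cg x (EK x Ex) e e0; exists r => // y Ey; exact/hr/EK.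
Qed.

Lemma boundaryP U x : open U -> closure U x -> ~ U x -> boundary U x.
Proof. by move=> oU cx nx; split => // /interior_subset. Qed.
End Compactness.

(** * Comparison by local maximum functions *)

Section Comparison.
Context {R : realType} {n : nat}.
Implicit Types (x y z h : 'rV[R]_n.+1) (Omega : set 'rV[R]_n.+1) (u : 'rV[R]_n.+1 -> R).

Definition ball_sup (eps : R) u x : R := sup [set u y | y in [set y | enorm (y - x) <= eps]].

Lemma ball_supP (eps : R) u x : 0 <= eps ->
  {within [set y | enorm (y - x) <= eps], continuous u} ->
  (exists2 y, enorm (y - x) <= eps & ball_sup eps u x = u y) /\
  forall y, enorm (y - x) <= eps -> u y <= ball_sup eps u x.
Proof.
move=> e0 cu; pose E : set 'rV[R]_n.+1 := [set y | enorm (y - x) <= eps].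
have Ex : E x by rewrite /E /= subrr enorm0.
have [c /set_mem cE cmax] := EVT_max_rV (ex_intro _ x Ex) (@compact_eball _ _ x eps) cu.
have ubc : ubound [set u y | y in E] (u c).
  by move=> _ [y Ey <-]; apply: cmax; exact/mem_set.
have sc : ball_sup eps u x = u c.
  apply/eqP; rewrite eq_le; apply/andP; split.
    by apply: ge_sup => //; exists (u x), x.
  by apply: ub_le_sup; [exists (u c)|exists c].
split; first by exists c.
by move=> y yx; rewrite sc; apply: ubc; exists y.
Qed.

(* Armstrong and Smart: comparison with cones makes the local maximum functions
   [x |-> max_{B(x, eps)} u] satisfy a discrete inequality, to which an elementary
   maximum principle applies. *)
Lemma ball_sup_discrete Omega u (eps : R) x : 0 < eps -> radial_sub Omega 0 u ->
  {within closure Omega, continuous u} ->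
  (forall y, enorm (y - x) <= 2 * eps -> Omega y) ->
  exists2 h, enorm h <= eps & forall k, enorm k <= eps ->
    2 * ball_sup eps u x <= ball_sup eps u (x + h) + ball_sup eps u (x + k).
Proof.
move=> e0 su cu BO.
have cE E : E `<=` Omega -> {within E, continuous u}.
  by move=> EO; apply: within_sub cu => y /EO; exact: subset_closure.
have e20 : 0 < 2 * eps by lra.
have cu2 : {within [set y | enorm (y - x) <= 2 * eps], continuous u} by exact: cE.
have inb k : enorm k <= eps -> [set y | enorm (y - (x + k)) <= eps] `<=` Omega.
  move=> ke y /= yk; apply: BO; have := enorm_triangle y (x + k) x.
  rewrite addrAC subrr add0r; lra.
have in0 : [set y | enorm (y - x) <= eps] `<=` Omega by move=> y /= yx; apply: BO; lra.
have [[y0 y0x Uy0] _] := ball_supP (ltW e0) (cE _ in0).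
have [[z0 z0x Uz0] z0max] := ball_supP (ltW e20) cu2.
(* The step goes halfway to the maximum point [z0] over the ball of radius [2 eps], so the ball
   around [x + h] contains [z0], while the ball around [x + k] contains [x]. Comparison with the
   cone over the large ball gives [2 u y0 <= u x + u z0]. *)
exists (2^-1 *: (z0 - x)); first by rewrite enormZ gtr0_norm//; lra.
move=> k ke.
have he : enorm (2^-1 *: (z0 - x)) <= eps by rewrite enormZ gtr0_norm//; lra.
have [_ Uh] := ball_supP (ltW e0) (cE _ (inb _ he)).
have [_ Uk] := ball_supP (ltW e0) (cE _ (inb _ ke)).
have h1 : u z0 <= ball_sup eps u (x + 2^-1 *: (z0 - x)).
  apply: Uh; rewrite (_ : z0 - (x + 2^-1 *: (z0 - x)) = 2^-1 *: (z0 - x)) //.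
  by apply/rowP => i; rewrite !mxE; field.
have h2 : u x <= ball_sup eps u (x + k) by apply: Uk; rewrite opprD addrA subrr sub0r enormN.
have ux : u x <= u z0 by rewrite -Uz0; apply: z0max; rewrite subrr enorm0 ltW.
have zmax y : enorm (y - x) <= 2 * eps -> u y <= u z0 by rewrite -Uz0; exact: z0max.
have y0x2 : enorm (y0 - x) <= 2 * eps by lra.
have := radial_sub_cone e20 su BO cu2 zmax y0x2.
have : (u z0 - u x) / (2 * eps) * enorm (y0 - x) <= (u z0 - u x) / (2 * eps) * eps.
  by rewrite ler_wpM2l// divr_ge0 ?subr_ge0// ltW.
rewrite (_ : (u z0 - u x) / (2 * eps) * eps = (u z0 - u x) / 2); last by field; rewrite gt_eqF.
rewrite Uy0; lra.
Qed.

(** The [a] and [b] are the values of [U1] and [U2] at [x0], [x0 + h1], [x0 + h2]. Each function is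
    stepped along its own direction and tested with that of the other, so the two inequalities add
    up to an equality. *)
Let midpoint_rigid (a0 a1 a2 b0 b1 b2 W : R) : W <= a0 + b0 ->
  a1 + b1 <= W -> a2 + b2 <= W -> 2 * a0 <= a1 + a2 -> 2 * b0 <= b2 + b1 ->
  W <= a1 + b1 /\ W <= a2 + b2.
Proof. by move=> *; split; lra. Qed.

(** As [a0] is largest, the values at the three points coincide for each function, and a fourth
    point cannot lie lower. Index 3 stands for [x0 + eps e_0]. *)
Let midpoint_rigid_max (a0 a1 a2 a3 b0 b1 b2 b3 W : R) : W <= a0 + b0 ->
  a1 + b1 <= W -> a2 + b2 <= W -> 2 * a0 <= a1 + a2 -> 2 * b0 <= b2 + b1 ->
  a1 <= a0 -> a2 <= a0 -> 2 * a0 <= a1 + a3 -> 2 * b0 <= b2 + b3 ->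
  W <= a3 + b3 /\ a0 <= a3.
Proof. by move=> *; split; lra. Qed.

(** If the sum were positive somewhere, let [E] be the set of maximum points of [U1 + U2] in [K],
    [F] the part of [E] where [U1] is largest, and [x0] a point of [F] with largest first
    coordinate. The discrete inequalities put [x0 + eps e_0] into [F] too, a contradiction. *)
Theorem radial_sub_comparison Omega u1 u2 : open Omega -> bounded_set Omega ->
  radial_sub Omega 0 u1 -> radial_sub Omega 0 u2 ->
  {within closure Omega, continuous u1} -> {within closure Omega, continuous u2} ->
  (forall x, boundary Omega x -> u1 x + u2 x <= 0) ->
  forall x, closure Omega x -> u1 x + u2 x <= 0.
Proof.
move=> oO bO su1 su2 cu1 cu2 bd xs xsO; rewrite leNgt; apply/negP => xs0.
have cK := bounded_closure_compact bO.
have cw : {within closure Omega, continuous (fun x => u1 x + u2 x)}.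
  by move=> x; exact: (continuousD (cu1 x) (cu2 x)).
have [xm /set_mem xmK xmmax] := EVT_max_rV (ex_intro _ xs xsO) cK cw.
pose M0 := u1 xm + u2 xm.
have M00 : 0 < M0 by apply: lt_le_trans xs0 _; apply: xmmax; exact/mem_set.
(* The boundary condition keeps this compact set inside [Omega], which gives one margin for all the
   balls that follow. *)
pose K := [set x | closure Omega x /\ M0 / 2 <= u1 x + u2 x].
have cKK : compact K by exact: compact_superlevel.
have KO : K `<=` Omega.
  move=> x [clx hx]; apply: contrapT => nx.
  have := bd x (boundaryP oO clx nx); lra.
have [r r0 hr] := compact_margin cKK oO KO.
pose r0' := r / 4; have r0'0 : 0 < r0' by rewrite divr_gt0.
have [M1 M10 hM1] := compact_bounded_fun cK cu1.
have [M2 M20 hM2] := compact_bounded_fun cK cu2.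
have [a a0 ha] := @radial_sub_lipschitz R n.+1 0 (M1 + M2) r0' (lexx _) (addr_ge0 M10 M20) r0'0.
(* At points near [K] but outside it, [a * eps <= M0 / 8] gives [U1 + U2 < M0 / 2 + M0 / 4], below
   the maximum [W >= M0]; a step of length [eps] that keeps the value [W] therefore stays in [K]. *)
pose eps := Num.min r0' (M0 / (8 * a)).
have eps0 : 0 < eps by rewrite lt_min r0'0 divr_gt0// mulr_gt0.
have epsr : eps <= r0' by rewrite ge_min lexx.
have epsa : a * eps <= M0 / 8.
  have : eps <= M0 / (8 * a) by rewrite ge_min lexx orbT.
  rewrite ler_pdivlMr ?mulr_gt0//; lra.
have rE : r = 4 * r0' by rewrite /r0'; field.
have cE u E : {within closure Omega, continuous u} -> E `<=` Omega -> {within E, continuous u}.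
  by move=> cu EO; apply: within_sub cu => y /EO; exact: subset_closure.
have near_in x y : K x -> enorm (y - x) <= 2 * r0' -> forall z, enorm (z - y) <= 2 * r0' -> Omega z.
  by move=> Kx yx z zy; apply: (hr x) => //; have := enorm_triangle z y x; lra.
have goodlip u : radial_sub Omega 0 u -> {within closure Omega, continuous u} ->
    (forall y, closure Omega y -> `|u y| <= M1 + M2) ->
    forall x y, K x -> enorm (y - x) <= 2 * r0' -> forall z, enorm (z - y) <= r0' ->
    u z <= u y + a * enorm (z - y).
  move=> su cu uM x y Kx yx z zy; apply: (ha Omega) => //.
  - by move=> t ty; apply: (near_in x y Kx yx); lra.
  - by apply: cE => // t /= ty; apply: (near_in x y Kx yx); lra.
  - by move=> t ty; apply/uM/subset_closure/(near_in x y Kx yx); lra.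
have uM1 y : closure Omega y -> `|u1 y| <= M1 + M2 by move=> /hM1; lra.
have uM2 y : closure Omega y -> `|u2 y| <= M1 + M2 by move=> /hM2; lra.
have lip1 := goodlip u1 su1 cu1 uM1; have lip2 := goodlip u2 su2 cu2 uM2.
pose U1 := ball_sup eps u1; pose U2 := ball_sup eps u2.
have UP u x y : {within closure Omega, continuous u} -> K x -> enorm (y - x) <= 2 * r0' ->
  (exists2 z, enorm (z - y) <= eps & ball_sup eps u y = u z) /\
  forall z, enorm (z - y) <= eps -> u z <= ball_sup eps u y.
  move=> cu Kx yx; apply: ball_supP; first exact: ltW.
  by apply: cE => // z /= zy; apply: (near_in x y Kx yx); lra.
have x2 x : enorm (x - x) <= 2 * r0' by rewrite subrr enorm0; lra.
have UL u : radial_sub Omega 0 u -> {within closure Omega, continuous u} ->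
    (forall x y, K x -> enorm (y - x) <= 2 * r0' -> forall z, enorm (z - y) <= r0' ->
    u z <= u y + a * enorm (z - y)) ->
    forall x y, K x -> K y -> enorm (y - x) <= r0' ->
    ball_sup eps u x <= ball_sup eps u y + a * enorm (y - x).
  move=> su cu lu x y Kx Ky yx.
  have [[z zx ->] _] := UP u x x cu Kx (x2 x); have [_ hy] := UP u y y cu Ky (x2 y).
  have h1 : enorm (z - x + y - y) <= eps by rewrite addrK.
  have h2 : z - (z - x + y) = - (y - x) by apply/rowP => i; rewrite !mxE; ring.
  have := lu y (z - x + y) Ky; rewrite addrK => /(_ ltac:(lra)) /(_ z).
  rewrite h2 enormN => /(_ yx) h3; have := hy _ h1; lra.
have cU u : radial_sub Omega 0 u -> {within closure Omega, continuous u} ->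
    (forall x y, K x -> enorm (y - x) <= 2 * r0' -> forall z, enorm (z - y) <= r0' ->
    u z <= u y + a * enorm (z - y)) -> {within K, continuous (ball_sup eps u)}.
  move=> su cu lu; apply/within_continuous_enorm => x Kx e e0.
  exists (Num.min r0' (e / a)); first by rewrite lt_min r0'0 divr_gt0.
  move=> y Ky; rewrite lt_min => /andP[y1 y2].
  have {}y2 : enorm (y - x) * a < e by rewrite -ltr_pdivlMr.
  have := UL u su cu lu x y Kx Ky (ltW y1).
  have := UL u su cu lu y x Ky Kx; rewrite enormB => /(_ (ltW y1)).
  by rewrite ltr_norml => *; apply/andP; split; lra.
have cU1 := cU u1 su1 cu1 lip1; have cU2 := cU u2 su2 cu2 lip2.
have cUU : {within K, continuous (fun x => U1 x + U2 x)}.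
  by move=> x; exact: (continuousD (cU1 x) (cU2 x)).
have Kxm : K xm by split => //; rewrite -/M0; lra.
have [x1 /set_mem Kx1 x1max] := EVT_max_rV (ex_intro _ xm Kxm) cKK cUU.
pose W := U1 x1 + U2 x1.
have Wmax x : K x -> U1 x + U2 x <= W by move=> Kx; apply: x1max; exact/mem_set.
have M0W : M0 <= W.
  apply: le_trans (Wmax xm Kxm).
  have [_ /(_ xm)] := UP u1 xm xm cu1 Kxm (x2 xm).
  have [_ /(_ xm)] := UP u2 xm xm cu2 Kxm (x2 xm).
  rewrite subrr enorm0 (ltW eps0) => /(_ isT) h1 /(_ isT) h2.
  by rewrite /M0 /U1 /U2 lerD.
have Wloc x h : K x -> enorm h <= eps ->
    U1 (x + h) + U2 (x + h) <= W /\ (W <= U1 (x + h) + U2 (x + h) -> K (x + h)).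
  move=> Kx he; have [Kh|nKh] := pselect (K (x + h)); first by split => //; exact: Wmax.
  have hx : enorm (x + h - x) <= 2 * r0' by rewrite addrAC subrr add0r; lra.
  have Oh : closure Omega (x + h).
    by apply: subset_closure; apply: (near_in x x Kx (x2 x)).
  have uh : u1 (x + h) + u2 (x + h) < M0 / 2.
    by rewrite ltNge; apply/negP => hh; apply: nKh.
  have [[z1 z1h E1] _] := UP u1 x (x + h) cu1 Kx hx.
  have [[z2 z2h E2] _] := UP u2 x (x + h) cu2 Kx hx.
  have := lip1 x (x + h) Kx hx z1 (le_trans z1h epsr).
  have := lip2 x (x + h) Kx hx z2 (le_trans z2h epsr).
  have : a * enorm (z1 - (x + h)) <= a * eps by rewrite ler_wpM2l// ltW.
  have : a * enorm (z2 - (x + h)) <= a * eps by rewrite ler_wpM2l// ltW.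
  by rewrite /U1 /U2 E1 E2 => *; split; lra.
pose E := [set x | K x /\ W <= U1 x + U2 x].
have cE' : compact E by exact: compact_superlevel.
have Ex1 : E x1 by [].
have EK : E `<=` K by move=> x [].
have [x2' /set_mem Ex2 x2max] := EVT_max_rV (ex_intro _ x1 Ex1) cE' (within_sub EK cU1).
pose F := [set x | E x /\ U1 x2' <= U1 x].
have cF : compact F by apply: compact_superlevel => //; exact: within_sub cU1.
have Fx2 : F x2' by [].
have cc : {within F, continuous (fun x => x 0 0)}.
  by apply: continuous_subspaceT; exact: coord_continuous.
have [x0 /set_mem [[Kx0 Wx0] Ux0] x0max] := EVT_max_rV (ex_intro _ x2' Fx2) cF cc.
have mmax x : E x -> U1 x <= U1 x0.
  by move=> Ex; apply: le_trans Ux0; apply: x2max; exact/mem_set.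
have inO y : enorm (y - x0) <= 2 * eps -> Omega y.
  by move=> yx; apply: (near_in x0 x0 Kx0 (x2 x0)); lra.
have [h1 h1e H1] := ball_sup_discrete eps0 su1 cu1 inO.
have [h2 h2e H2] := ball_sup_discrete eps0 su2 cu2 inO.
have {}H1 : forall k, enorm k <= eps -> 2 * U1 x0 <= U1 (x0 + h1) + U1 (x0 + k) by exact: H1.
have {}H2 : forall k, enorm k <= eps -> 2 * U2 x0 <= U2 (x0 + h2) + U2 (x0 + k) by exact: H2.
have [W1 K1] := Wloc x0 h1 Kx0 h1e; have [W2 K2] := Wloc x0 h2 Kx0 h2e.
have A1 := H1 h2 h2e; have A2 := H2 h1 h1e; have Wx0' := Wmax x0 Kx0.
have [W1' W2'] := midpoint_rigid Wx0 W1 W2 A1 A2.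
have E1 : E (x0 + h1) := conj (K1 W1') W1'.
have E2 : E (x0 + h2) := conj (K2 W2') W2'.
have B1 := mmax _ E1; have B2 := mmax _ E2.
have ee : enorm (eps *: (delta_mx 0 0 : 'rV[R]_n.+1)) <= eps.
  by rewrite enormZ enorm_delta mulr1 gtr0_norm.
have [W3 K3] := Wloc x0 _ Kx0 ee.
have C1 := H1 _ ee; have C2 := H2 _ ee.
have [W3' U3'] := midpoint_rigid_max Wx0 W1 W2 A1 A2 B1 B2 C1 C2.
have F3 : F (x0 + eps *: delta_mx 0 0).
  by split; [exact: (conj (K3 W3') W3')|exact: (le_trans Ux0)].
by have := x0max _ (mem_set F3); rewrite !mxE eqxx mulr1 gerDl leNgt eps0.
Qed.
End Comparison.

(** * The Perron infimum *)

Section Perron.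
Context {R : realType} {d : nat}.
Implicit Types (x y z : 'rV[R]_d) (f g u w psi : 'rV[R]_d -> R).

Lemma continuous_near_dist f x (e : R) : {for x, continuous f} -> 0 < e ->
  \forall y \near x, `|f y - f x| < e.
Proof.
move=> /(@cvgr_dist_lt _ R^o) cf e0; have := cf e e0.
by apply: filterS => y; rewrite distrC.
Qed.

Let minr_dist (a b a' b' c e : R) : `|a - a'| < e -> `|b - b'| < e ->
  `|Num.min a (b - c) - Num.min a' (b' - c)| < e.
Proof.
rewrite !ltr_norml => /andP[? ?] /andP[? ?].
by case: (leP a (b - c)); case: (leP a' (b' - c)) => ? ?; apply/andP; split; lra.
Qed.

Lemma continuous_dist (F : R -> R) (s e : R) : continuous F -> 0 < e ->
  exists2 r, 0 < r & forall t, `|t - s| < r -> `|F t - F s| < e.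
Proof.
move=> cF e0; have := cF s => /(@cvgr_dist_lt _ R^o)/(_ _ e0)/nbhs_ballP[r /= r0 hr].
by exists r => // t ts; rewrite distrC; apply: hr; rewrite /ball /= distrC.
Qed.

Lemma within_interior_continuous K U f x : open U -> U `<=` K -> U x ->
  {within K, continuous f} -> {for x, continuous f}.
Proof.
move=> oU UK Ux /within_continuous_enorm cf.
move=> A /nbhs_ballP[e /= e0 eA].
have [r r0 hr] := cf x (UK x Ux) e e0.
have [s s0 hs] := open_enormP oU Ux.
apply/nbhs_enormP; exists (Num.min r s); first by rewrite lt_min r0 s0.
by move=> y; rewrite lt_min => /andP[yr /hs/UK Ky]; apply: eA; rewrite /ball /= distrC; exact: hr.
Qed.

Variables (Omega : set 'rV[R]_d) (F : R -> R) (C : R) (phi ulow uup : 'rV[R]_d -> R).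
Hypotheses (oO : open Omega) (bO : bounded_set Omega).
Hypotheses (cF : continuous F) (F0 : forall s, 0 <= F s) (FC : forall s, F s <= C).
Hypothesis hlow : visc_solution Omega (fun _ => C) phi ulow.
Hypothesis hup : visc_solution Omega (fun _ => 0) phi uup.
Hypothesis low_up : forall x, closure Omega x -> ulow x <= uup x.

Let P := perron_class Omega F ulow uup.
Definition perron_inf x : R := inf [set w x | w in P].
Let u := perron_inf.
Let clO : Omega `<=` closure Omega := @subset_closure _ Omega.

Lemma perron_class_uup : P uup.
Proof.
have [cup _ sup _] := hup; split => //.
  by move=> x psi Ox cpsi h; apply: le_trans (F0 _); exact: sup h.
by move=> x Ox; rewrite low_up// lexx.
Qed.

Let lbP x : closure Omega x -> has_lbound [set w x | w in P].
Proof. by move=> Ox; exists (ulow x) => _ [w [_ _ hw] <-]; have /andP[] := hw x Ox. Qed.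

Let neP x : [set w x | w in P] !=set0.
Proof. by exists (uup x), uup => //; exact: perron_class_uup. Qed.

Lemma perron_inf_le w x : P w -> closure Omega x -> u x <= w x.
Proof. by move=> Pw Ox; apply: ge_inf; [exact: lbP|exists w]. Qed.

Lemma perron_inf_adherent x (e : R) : closure Omega x -> 0 < e ->
  exists2 w, P w & w x < u x + e.
Proof.
move=> Ox e0.
have [_ [w Pw <-] we] := inf_adherent e0 (conj (neP x) (lbP Ox)).
by exists w.
Qed.

Lemma perron_inf_low x : closure Omega x -> ulow x <= u x.
Proof.
move=> Ox; apply: lb_le_inf; first exact: neP.
by move=> _ [w [_ _ hw] <-]; have /andP[] := hw x Ox.
Qed.

Lemma perron_inf_up x : closure Omega x -> u x <= uup x.
Proof. by move=> Ox; apply: perron_inf_le => //; exact: perron_class_uup. Qed.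

Lemma perron_inf_ereal x : closure Omega x ->
  (u x)%:E = ereal_inf [set (w x)%:E | w in P].
Proof.
move=> Ox; rewrite /u /perron_inf -ereal_inf_EFin; last 2 first.
- exact: lbP.
- exact: neP.
by rewrite image_comp.
Qed.

Lemma perron_inf_boundary x : boundary Omega x -> u x = phi x.
Proof.
move=> bx; have [clx _] := bx; have [_ _ _ lx] := hlow; have [_ _ _ ux] := hup.
by apply/eqP; rewrite eq_le -{1}(ux x bx) -(lx x bx) perron_inf_up// perron_inf_low.
Qed.

(** The constant [a] depends only on [C] and the bounds of [ulow] and [uup]. A member [w] almost
    optimal at [z] satisfies [w y <= w z + a |y - z|], and [u y <= w y]. *)
Lemma perron_inf_lipschitz x : Omega x -> exists2 r, 0 < r & exists2 a, 0 < a &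
  forall y z, enorm (y - x) <= r -> enorm (z - x) <= r -> u y <= u z + a * enorm (y - z).
Proof.
move=> Ox; have [r r0 hr] := open_enormP oO Ox.
have cK := bounded_closure_compact bO.
have [cl _ _ _] := hlow; have [cu _ _ _] := hup.
have [M1 M10 hM1] := compact_bounded_fun cK cl.
have [M2 M20 hM2] := compact_bounded_fun cK cu.
have C0 : 0 <= C by apply: le_trans (F0 0) (FC 0).
have r40 : 0 < 2 * (r / 4) by lra.
have [a a0 ha] := @radial_sub_lipschitz R d C (M1 + M2) _ C0 (addr_ge0 M10 M20) r40.
exists (r / 4); first by lra.
exists a => // y z yx zx; apply/ler_addgt0Pr => e e0.
have Oy t : enorm (t - y) <= 2 * (r / 4) -> Omega t.
  by move=> ty; apply: hr; have := enorm_triangle t y x; lra.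
have Oz : Omega z by apply: hr; lra.
have [w Pw wz] := perron_inf_adherent (clO Oz) e0.
have Oyy : Omega y by apply: hr; lra.
have uw := perron_inf_le Pw (clO Oyy).
have [cw sw bw] := Pw.
have sw' : radial_sub Omega C (fun y => - w y) by apply: visc_super_radial sw => // t _; exact: FC.
have := ha Omega _ y sw' Oy.
have cw' : {within [set t | enorm (t - y) <= 2 * (r / 4)], continuous (fun y => - w y)}.
  have cw1 : {within [set t | enorm (t - y) <= 2 * (r / 4)], continuous w}.
    by apply: within_sub cw => t /Oy/clO.
  by move=> t; exact: (continuousN (cw1 t)).
have wM t : enorm (t - y) <= 2 * (r / 4) -> `|- w t| <= M1 + M2.
  move=> /Oy/clO Ot; have := hM1 t Ot; have := hM2 t Ot; have /andP[? ?] := bw t Ot.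
  by rewrite normrN !ler_norml => /andP[? ?] /andP[? ?]; apply/andP; split; lra.
move=> /(_ cw' wM z); have zy : enorm (z - y) <= 2 * (r / 4).
  by have := enorm_triangle z x y; rewrite (enormB x y); lra.
by move=> /(_ zy); rewrite (enormB z y); lra.
Qed.

(** On the boundary, [u] is squeezed between [ulow] and [uup], which share their boundary values. *)
Lemma perron_inf_continuous : {within closure Omega, continuous u}.
Proof.
apply/within_continuous_enorm => x clx e e0.
have [Ox|nOx] := pselect (Omega x).
  have [r r0 [a a0 ha]] := perron_inf_lipschitz Ox.
  exists (Num.min r (e / a)); first by rewrite lt_min r0 divr_gt0.
  move=> y _; rewrite lt_min => /andP[yr ya].
  have {}ya : enorm (y - x) * a < e by rewrite -ltr_pdivlMr.
  have xx : enorm (x - x) <= r by rewrite subrr enorm0 ltW.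
  have := ha y x (ltW yr) xx; have := ha x y xx (ltW yr).
  by rewrite (enormB x y) ltr_norml => ? ?; apply/andP; split; lra.
have bx := boundaryP oO clx nOx.
have [/within_continuous_enorm cl _ _ lx] := hlow.
have [/within_continuous_enorm cu _ _ ux] := hup.
have [r1 r10 h1] := cl x clx e e0; have [r2 r20 h2] := cu x clx e e0.
exists (Num.min r1 r2); first by rewrite lt_min r10.
move=> y cy; rewrite lt_min => /andP[y1 y2].
have := h1 y cy y1; have := h2 y cy y2; rewrite (lx x bx) (ux x bx) (perron_inf_boundary bx).
have := perron_inf_low cy; have := perron_inf_up cy.
by rewrite !ltr_norml => ? ? /andP[? ?] /andP[? ?]; apply/andP; split; lra.
Qed.

Let Ck2_cont U psi x : Ck 2 U psi -> U x -> {for x, continuous psi}.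
Proof. by move=> /Ck2P cpsi Ux; have [] := cpsi x Ux. Qed.

(** A member [w] almost attaining the infimum at [x0] replaces [u]. Subtracting [|y - x0|^4] from
    the test function forces the minimum of [w - psi'] close to [x0], where the inequality for [w]
    contradicts the assumed strict one by continuity. *)
Lemma perron_inf_super : visc_super Omega F u.
Proof.
move=> x0 psi Ox cpsi hmin; rewrite leNgt; apply/negP => hlt.
pose psi' := psi \+ rquartic x0 0 0 (-1).
have cpsi' : Ck 2 Omega psi' by apply: Ck2D => //; exact: Ck2_rquartic.
have psiE y : psi' y = psi y - esq (y - x0) ^+ 2 by rewrite /psi' /= /rquartic; ring.
have e00 : esq (x0 - x0) = 0 by rewrite -enorm_sqr subrr enorm0 expr0n.
have lapE : inf_laplacian psi' x0 = inf_laplacian psi x0 by exact: inf_laplacianD_quartic oO _ _.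
pose m := (inf_laplacian psi x0 - F (u x0)) / 2; have m0 : 0 < m by rewrite /m; lra.
have [sg sg0 hsg] := continuous_dist (u x0) cF m0.
have sg20 : 0 < sg / 2 by rewrite divr_gt0.
have n1 := continuous_near_dist (inf_laplacian_continuous cpsi' Ox) m0.
have n2 := continuous_near_dist (Ck2_cont cpsi' Ox) sg20.
have n3 : \forall y \near x0, Omega y by exact: open_nbhs_nbhs.
have /nbhs_enormP[r r0 hr] : \forall y \near x0,
    (`|inf_laplacian psi' y - inf_laplacian psi' x0| < m /\ `|psi' y - psi' x0| < sg / 2) /\
    (Omega y /\ u x0 - psi x0 <= u y - psi y).
  by exact: filterI (filterI n1 n2) (filterI n3 hmin).
pose r' := r / 2; have r'0 : 0 < r' by rewrite divr_gt0.
have {}hr y : enorm (y - x0) <= r' -> [/\ `|inf_laplacian psi' y - inf_laplacian psi' x0| < m,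
    `|psi' y - psi' x0| < sg / 2, Omega y & u x0 - psi x0 <= u y - psi y].
  by move=> yx; have [|[h1 h2] [h3 h4]] := hr y; first by rewrite /r' in yx; lra.
(* At the minimum point [|y - x0|^4 < tau]: the bound [r'^4] keeps it off the sphere, and [sg / 2]
   keeps [w y] within [sg] of [u x0]. *)
pose tau := Num.min (sg / 2) (r' ^+ 4).
have tau0 : 0 < tau by rewrite lt_min sg20 exprn_gt0.
have [w Pw wx0] := perron_inf_adherent (clO Ox) tau0.
have [cw sw bw] := Pw.
pose E : set 'rV[R]_d := [set y | enorm (y - x0) <= r'].
have EO : E `<=` Omega by move=> y /hr[].
have cG : {within E, continuous (w - psi')}.
  have cw' : {within E, continuous w} by apply: within_sub cw => y /EO/clO.
  have cp' : {within E, continuous psi'}.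
    apply/within_continuous_enorm => y Ey e e0.
    have /nbhs_enormP[s s0 hs] := continuous_near_dist (Ck2_cont cpsi' (EO y Ey)) e0.
    by exists s => // z _; exact: hs.
  by move=> y; exact: (continuousB (cw' y) (cp' y)).
have Ex0 : E x0 by rewrite /E /= subrr enorm0 ltW.
have [y /set_mem Ey ymin] := EVT_min_rV (ex_intro _ x0 Ex0) (@compact_eball _ _ x0 r') cG.
have {}ymin z : enorm (z - x0) <= r' -> w y - psi' y <= w z - psi' z.
  by move=> zE; apply: ymin; exact/mem_set.
have [l1 p1 Oy uy] := hr y Ey.
have ymx := ymin x0 Ex0; have uwy := perron_inf_le Pw (clO Oy).
have ts : tau <= sg / 2 by rewrite ge_min lexx.
have tr : tau <= r' ^+ 4 by rewrite ge_min lexx orbT.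
have p0 : psi' x0 = psi x0 by rewrite psiE e00 expr0n /= subr0.
have esq4 : enorm (y - x0) ^+ 4 < r' ^+ 4.
  have E4 : enorm (y - x0) ^+ 4 = esq (y - x0) ^+ 2 by rewrite -enorm_sqr -exprM.
  rewrite E4; have := psiE y; lra.
have yr : enorm (y - x0) < r' by move: esq4; rewrite ltr_pXn2r// ?nnegrE ?enorm_ge0// ltW.
have touch : \forall z \near y, w y - psi' y <= w z - psi' z.
  apply/nbhs_enormP; exists (r' - enorm (y - x0)); first by rewrite subr_gt0.
  by move=> z zy; apply: ymin; have := enorm_triangle z y x0; lra.
have := sw y psi' Oy cpsi' touch.
have wux : `|w y - u x0| < sg.
  move: p1; rewrite !ltr_norml => /andP[? ?]; apply/andP; split; last by lra.
  have := psiE y; have := sqr_ge0 (esq (y - x0)); lra.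
have := hsg _ wux; move: l1; rewrite lapE !ltr_norml => /andP[? ?] /andP[? ?].
have : m + m = inf_laplacian psi x0 - F (u x0) by rewrite /m; field.
lra.
Qed.

(* Otherwise lowering [u] to a test function near the touching point gives a
   smaller member of the class. *)
Lemma perron_inf_sub : visc_sub Omega F u.
Proof.
move=> x0 psi Ox cpsi hmax; rewrite leNgt; apply/negP => hlt.
have [cl sl _ _] := hlow.
(* If [ulow] met [u] at [x0], [psi] would also touch [ulow] from above there, and [C <=
   inf_laplacian psi x0 < F (u x0) <= C]. Hence there is room to lower [u]. *)
have low_lt : ulow x0 < u x0.
  rewrite lt_neqAle perron_inf_low ?andbT; last exact: clO.
  apply/eqP => E; have : C <= inf_laplacian psi x0.
    apply: sl => //; have nO : \forall y \near x0, Omega y by exact: open_nbhs_nbhs.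
    apply: filterS (filterI hmax nO) => y [h Oy].
    by have := perron_inf_low (clO Oy); rewrite E; lra.
  by have := FC (u x0); lra.
pose psi' := psi \+ rquartic x0 (u x0 - psi x0) 0 1.
have cpsi' : Ck 2 Omega psi' by apply: Ck2D => //; exact: Ck2_rquartic.
have psiE y : psi' y = psi y + (u x0 - psi x0) + esq (y - x0) ^+ 2.
  by rewrite /psi' /= /rquartic; ring.
have e00 : esq (x0 - x0) = 0 by rewrite -enorm_sqr subrr enorm0 expr0n.
have p0 : psi' x0 = u x0 by rewrite psiE e00 expr0n /=; ring.
have lapE : inf_laplacian psi' x0 = inf_laplacian psi x0 by exact: inf_laplacianD_quartic oO _ _.
pose m := (F (u x0) - inf_laplacian psi x0) / 2; have m0 : 0 < m by rewrite /m; lra.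
have mm : m + m = F (u x0) - inf_laplacian psi x0 by rewrite /m; field.
have [sg sg0 hsg] := continuous_dist (u x0) cF m0.
have sg20 : 0 < sg / 2 by rewrite divr_gt0.
pose ka := (u x0 - ulow x0) / 4; have ka0 : 0 < ka by rewrite /ka; lra.
have kaE : 4 * ka = u x0 - ulow x0 by rewrite /ka; field.
have n1 := continuous_near_dist (inf_laplacian_continuous cpsi' Ox) m0.
have n2 := continuous_near_dist (Ck2_cont cpsi' Ox) sg20.
have n2' := continuous_near_dist (Ck2_cont cpsi' Ox) ka0.
have n4 := continuous_near_dist (within_interior_continuous oO clO Ox cl) ka0.
have n3 : \forall y \near x0, Omega y by exact: open_nbhs_nbhs.
have /nbhs_enormP[r r0 hr] : \forall y \near x0,
    (`|inf_laplacian psi' y - inf_laplacian psi' x0| < m /\ `|psi' y - psi' x0| < sg / 2) /\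
    ((`|psi' y - psi' x0| < ka /\ `|ulow y - ulow x0| < ka) /\
     (Omega y /\ u y - psi y <= u x0 - psi x0)).
  by exact: filterI (filterI n1 n2) (filterI (filterI n2' n4) (filterI n3 hmax)).
have {}hr y : enorm (y - x0) < r -> [/\ inf_laplacian psi' y < F (u x0) - m,
    `|psi' y - u x0| < sg / 2, ulow y <= psi' y - ka, Omega y & u y <= psi' y - esq (y - x0) ^+ 2].
  move=> yx; have [[h1 h2] [[h2' h4] [h3 h5]]] := hr y yx.
  split => //; last by have := psiE y; lra.
  - by move: h1; rewrite lapE ltr_norml => /andP[? ?]; lra.
  - by rewrite -p0.
  - by move: h2' h4; rewrite p0 !ltr_norml => /andP[? ?] /andP[? ?]; lra.
pose r' := r / 2; have r'0 : 0 < r' by rewrite divr_gt0.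
have r'r : r' < r by rewrite /r'; lra.
(* [eta <= ka] keeps the lowered function above [ulow]; [eta <= r'^4] makes it agree with [u] from
   radius [r'] on, so the gluing at radius [r] is continuous; [eta <= sg / 2] keeps its modified
   values in the range where [F] is close to [F (u x0)]. *)
pose eta := Num.min (Num.min (sg / 2) ka) (r' ^+ 4).
have eta0 : 0 < eta by rewrite !lt_min sg20 ka0 exprn_gt0.
have eta1 : eta <= sg / 2 by rewrite !ge_min lexx.
have eta2 : eta <= ka by rewrite !ge_min lexx orbT.
have eta3 : eta <= r' ^+ 4 by rewrite ge_min lexx orbT.
pose w y := if enorm (y - x0) < r then Num.min (u y) (psi' y - eta) else u y.
have wu y : w y <= u y by rewrite /w; case: ifP => // _; rewrite ge_min lexx.
have w_far y : r' <= enorm (y - x0) -> w y = u y.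
  move=> yr; rewrite /w; case: ifP => // yr2; apply: min_l.
  have [_ _ _ _ h] := hr y yr2; apply: (le_trans h); rewrite lerD2l lerN2.
  apply: (le_trans eta3); rewrite -enorm_sqr -exprM.
  by rewrite ler_pXn2r// nnegrE ?enorm_ge0// ltW.
have w_near y : enorm (y - x0) < r -> w y <= psi' y - eta.
  by move=> yr; rewrite /w yr ge_min lexx orbT.
have Pw : P w; last first.
  have := perron_inf_le Pw (clO Ox); have := w_near x0.
  by rewrite subrr enorm0 p0 => /(_ r0); lra.
have := perron_inf_continuous => /within_continuous_enorm cu.
split.
- apply/within_continuous_enorm => x clx e e0.
  have [s s0 hs] := cu x clx e e0.
  have [xr|xr] := ltP (enorm (x - x0)) r.
    have [_ _ _ Oxx _] := hr x xr.
    have /nbhs_enormP[t t0 ht] := continuous_near_dist (Ck2_cont cpsi' Oxx) e0.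
    exists (Num.min (Num.min s t) (r - enorm (x - x0))).
      by rewrite !lt_min s0 t0 subr_gt0.
    move=> y cy; rewrite !lt_min => /andP[/andP[ys yt] yr].
    have yr' : enorm (y - x0) < r by have := enorm_triangle y x x0; lra.
    by rewrite /w xr yr'; apply: minr_dist; [exact: hs|exact: ht].
  exists (Num.min s (r - r')); first by rewrite lt_min s0 subr_gt0.
  move=> y cy; rewrite lt_min => /andP[ys yr].
  rewrite !w_far; [exact: hs|lra|].
  by have := enorm_triangle x y x0; rewrite (enormB x y); lra.
- move=> y f Oy cf touch.
  (* Where [w = u], a function touching [w] from below also touches [u], as [w <= u]. Elsewhere it
     touches the [C^2] function [psi' - eta], and the two infinity Laplacians are compared
     classically. *)
  have [wuy|wuy] := eqVneq (w y) (u y).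
    rewrite wuy; apply: perron_inf_super => //; apply: filterS touch => z.
    by rewrite wuy => h; apply: (le_trans h); rewrite lerD2r.
  have yr' : enorm (y - x0) < r' by rewrite ltNge; apply/negP => /w_far/eqP; exact/negP.
  have yr : enorm (y - x0) < r by lra.
  have wy : w y = psi' y - eta.
    by move: wuy; rewrite /w yr /Num.min; case: ltP; rewrite ?eqxx.
  have [l1 p1 _ _ _] := hr y yr.
  have : inf_laplacian f y <= inf_laplacian psi' y.
    apply: (touching_inf_laplacian oO Oy cf cpsi').
    have nr : \forall z \near y, enorm (z - x0) < r.
      apply/nbhs_enormP; exists (r - enorm (y - x0)); first by rewrite subr_gt0.
      by move=> z zy; have := enorm_triangle z y x0; lra.
    apply: filterS (filterI touch nr) => z [h zr].
    by have := w_near z zr; rewrite wy in h; lra.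
  have wux : `|w y - u x0| < sg.
    by rewrite wy; move: p1; rewrite !ltr_norml => /andP[? ?]; apply/andP; split; lra.
  by have := hsg _ wux; rewrite ltr_norml => /andP[? ?]; lra.
- move=> y cy; apply/andP; split; last by apply: (le_trans (wu y)); exact: perron_inf_up.
  rewrite /w; case: ifP => yr; last exact: perron_inf_low.
  rewrite le_min perron_inf_low//=; have [_ _ h _ _] := hr y yr; lra.
Qed.

Lemma perron_inf_minimal : minimal_visc_solution Omega F phi ulow uup u.
Proof.
split; first exact: perron_inf_ereal.
split; [exact: perron_inf_continuous|exact: perron_inf_sub|exact: perron_inf_super|
  exact: perron_inf_boundary].
Qed.
End Perron.

(** * Bounds, regularity and conclusion *)

Section Final.
Context {R : realType}.

(** The perturbation [et |y - z|^2] has its centre [z] outside [Omega], so the test function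
    [- et |y - z|^2] has strictly negative infinity Laplacian throughout [Omega]. Its size stays
    below half the supposed excess over [m], which puts the maximum point where [v > m]. *)
Lemma radial_max_principle n (Omega : set 'rV[R]_n.+1) v (m : R) : open Omega ->
  bounded_set Omega -> {within closure Omega, continuous v} ->
  radial_sub (Omega `&` [set y | m < v y]) 0 v ->
  (forall x, boundary Omega x -> v x <= m) -> forall x, closure Omega x -> v x <= m.
Proof.
move=> oO bO cv sv bd xs clxs; rewrite leNgt; apply/negP => xm.
have cK := bounded_closure_compact bO.
have [z nz] : exists z, ~ Omega z.
  case: bO => M [_ bM]; exists ((`|M| + 2) *: delta_mx 0 0) => Oz.
  have h : M < `|M| + 1 by have := ler_norm M; lra.
  have := bM _ h _ Oz => /=; have := coord_le_norm ((`|M| + 2) *: delta_mx 0 0 : 'rV[R]_n.+1) 0.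
  by rewrite !mxE !eqxx mulr1 ger0_norm; [lra|have := normr_ge0 M; lra].
have ce : {within closure Omega, continuous (fun y => esq (y - z))}.
  by apply: continuous_subspaceT; exact: esq_continuous.
have [D D0 hD] := compact_bounded_fun cK ce.
pose et := (v xs - m) / (2 * (D + 1)); have D1 : 0 < 2 * (D + 1) by lra.
have et0 : 0 < et by rewrite divr_gt0// subr_gt0.
have etE : et * (2 * (D + 1)) = v xs - m by rewrite divfK// gt_eqF.
have cG : {within closure Omega, continuous (fun y => v y + et * esq (y - z))}.
  have cet : {within closure Omega, continuous (cst et : 'rV[R]_n.+1 -> R)}.
    by apply: continuous_subspaceT; exact: cst_continuous.
  by move=> x; exact: (continuousD (cv x) (continuousM (cet x) (ce x))).
have [y /set_mem cly ymax] := EVT_max_rV (ex_intro _ xs clxs) cK cG.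
have {}ymax t : closure Omega t -> v t + et * esq (t - z) <= v y + et * esq (y - z).
  by move=> ct; apply: ymax; exact/mem_set.
have yD : et * esq (y - z) <= et * D.
  by rewrite ler_wpM2l ?(ltW et0)//; apply: le_trans (hD y cly); exact: ler_norm.
have ym : m < v y.
  have := ymax xs clxs; have : 0 <= et * esq (xs - z) by rewrite mulr_ge0 ?esq_ge0// ltW.
  lra.
have Oy : Omega y.
  by apply: contrapT => nOy; have := bd y (boundaryP oO cly nOy); lra.
have := sv z 0 (- et) 0 y (conj Oy ym).
have h : \forall t \near y, v t - rquartic z 0 (- et) 0 t <= v y - rquartic z 0 (- et) 0 y.
  have nO : \forall t \near y, Omega t by exact: open_nbhs_nbhs.
  apply: filterS nO => t /(@subset_closure _ Omega)/ymax.
  by rewrite /rquartic; lra.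
move=> /(_ h) /=; rewrite !mulr0 !mul0r !addr0.
have : 0 < esq (y - z).
  rewrite lt_neqAle esq_ge0 andbT -enorm_sqr eq_sym expf_eq0 /=.
  by apply/negP => /eqP/enorm_eq0/eqP; rewrite subr_eq0 => /eqP yz; rewrite yz in Oy.
move=> s0; rewrite leNgt => /negP; apply.
rewrite oppr0 sqrrN mulrN oppr_lt0; apply: mulr_gt0 => //; apply: mulr_gt0.
  exact: mulr_gt0.
exact: exprn_gt0.
Qed.

Lemma mcshane d (A : set 'rV[R]_d) (g : 'rV[R]_d -> R) (K : R) : A !=set0 -> 0 <= K ->
  (forall x y, A x -> A y -> g x <= g y + K * `|x - y|) ->
  exists2 f : 'rV[R]_d -> R, forall x, A x -> f x = g x &
    forall x y, `|f x - f y| <= K * `|x - y|.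
Proof.
move=> [y0 Ay0] K0 gK; pose S x := [set g y + K * `|x - y| | y in A].
have S0 x : S x !=set0 by exists (g y0 + K * `|x - y0|), y0.
have Slb x : has_lbound (S x).
  exists (g y0 - K * `|x - y0|) => _ [y Ay <-].
  have := gK y0 y Ay0 Ay; have : `|y0 - y| <= `|x - y0| + `|x - y|.
    by rewrite (distrC x y0); have := ler_distD x y0 y.
  by move=> /(ler_wpM2l K0); rewrite mulrDr; lra.
exists (fun x => inf (S x)) => [x Ax|].
  apply/eqP; rewrite eq_le; apply/andP; split.
    by apply: ge_inf => //; exists x => //; rewrite subrr normr0 mulr0 addr0.
  by apply: lb_le_inf => // _ [y Ay <-]; exact: gK.
have h x z : inf (S x) <= inf (S z) + K * `|x - z|.
  rewrite -lerBlDr; apply: lb_le_inf => // _ [y Ay <-].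
  rewrite lerBlDr; apply: (@le_trans _ _ (g y + K * `|x - y|)).
    by apply: ge_inf => //; exists y.
  by have := ler_wpM2l K0 (ler_distD z x y); rewrite mulrDr; lra.
move=> x y; rewrite ler_norml; have := h x y; have := h y x; rewrite (distrC y x).
by move=> ? ?; apply/andP; split; lra.
Qed.

(** In the direction [g] of the gradient itself the derivative is [|g|^2], and the one-sided bound
    makes it at most [a |g|]. *)
Lemma enorm_grad_le d (f : 'rV[R]_d -> R) x (a : R) : 0 <= a -> differentiable f x ->
  (\forall y \near x, f y <= f x + a * enorm (y - x)) -> enorm (grad f x) <= a.
Proof.
move=> a0 df fa; set g := grad f x.
have [->|g0] := eqVneq (enorm g) 0; first by [].
have gpos : 0 < enorm g by rewrite lt_neqAle eq_sym g0 enorm_ge0.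
rewrite -(ler_pM2r gpos) -expr2 enorm_sqr.
have -> : esq g = 'D_g f x by rewrite derive_dotr// /dotr; apply: eq_bigr => i _; rewrite expr2.
apply/ler_addgt0Pr => e e0.
have dv : derivable f x g by exact: diff_derivable.
have := dv => /(@cvgr_dist_lt _ R^o)/(_ _ e0); rewrite near_withinE -/('D_g f x) => n1.
have n2 := near_line g fa.
have : \forall t \near (0 : R),
    (t != 0 -> `|'D_g f x - t^-1 *: ((f \o shift x) (t *: g) - f x)| < e) /\
    f (x + t *: g) <= f x + a * enorm (x + t *: g - x).
  by exact: filterI n1 n2.
move=> /nbhs_ballP[r /= r0 hr].
have r2 : 0 < r / 2 by rewrite divr_gt0.
have [] := hr (r / 2); first by rewrite /ball /= sub0r normrN gtr0_norm//; lra.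
move=> /(_ (lt0r_neq0 r2)); rewrite /shift /= [_ + x]addrC /GRing.scale /= => h1 h2.
rewrite addrAC subrr add0r enormZ gtr0_norm// in h2.
have h3 : (r / 2)^-1 * (f (x + (r / 2) *: g) - f x) <= a * enorm g.
  by rewrite mulrC ler_pdivrMr//; move: h2; rewrite mulrCA; lra.
move: h1; rewrite ltr_norml => /andP[_ ?]; lra.
Qed.

Lemma first_order_approx_local d (f g : 'rV[R]_d -> R) x :
  (\forall y \near x, f y = g y) -> first_order_approx f x -> first_order_approx g x.
Proof.
move=> fg h e e0; have [q [r r0 hr]] := h e e0.
have fgx : f x = g x := nbhs_singleton fg.
have /nbhs_enormP[s s0 hs] := fg.
have D0 : 0 < d%:R + 1 :> R by rewrite ltr_wpDl.
exists q, (Num.min r (s / (d%:R + 1) / 2)); first by rewrite lt_min r0 !divr_gt0.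
move=> v; rewrite le_min => /andP[vr vs]; rewrite -fgx -hs; first exact: hr.
rewrite addrAC subrr add0r; apply: (le_lt_trans (enorm_le_norm _)).
have sE : s = s / (d%:R + 1) * (d%:R + 1) by rewrite divfK// gt_eqF.
have c0 : 0 < s / (d%:R + 1) by rewrite divr_gt0.
rewrite sE; move: (s / (d%:R + 1)) c0 vs => c c0 vs.
have d0 : 0 <= d%:R :> R by [].
have := ler_wpM2l d0 vs; have : 0 <= d%:R * c by rewrite mulr_ge0// ltW.
lra.
Qed.

(** * The right-hand side of the problem *)

Section Rhs.
Variables (gamma eps : R) (B : R -> R).
Hypotheses (hgamma : 0 <= gamma < 1) (hB : admissible_B gamma B) (eps0 : 0 < eps).

Let e := eps `^ alpha gamma.
Let s0 := delta gamma / 2 * e.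

Let e_gt0 : 0 < e. Proof. exact: powR_gt0. Qed.

Let delta_gt0 : 0 < delta gamma.
Proof.
case/andP: hgamma => g0 _; rewrite mulr_gt0// powR_gt0// divr_gt0//; lra.
Qed.

Let s0_gt0 : 0 < s0. Proof. by rewrite mulr_gt0// divr_gt0. Qed.

(** Below [s0] the factor [B] vanishes, so truncating the argument of the power is harmless and
    keeps it away from its singularity; continuity and the upper bound are read off this form. *)
Lemma rhs_maxE s : rhs gamma B eps s = B (s / e) * Num.max s s0 `^ (- gamma).
Proof.
case: hB => _ _ B0 _; rewrite /rhs -/e -/s0; case: ifPn => [ss|]; last first.
  by rewrite -ltNge => ss; rewrite max_l// ltW.
by rewrite B0 ?mul0r// ler_pdivrMr.
Qed.

Lemma rhs_continuous : continuous (rhs gamma B eps).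
Proof.
case: hB => lB _ _ _.
have cB : continuous B.
  case: lB => M [_ hM] x A /nbhs_ballP[r /= r0 rA].
  have M0 : 0 < `|M| + 1 by have := normr_ge0 M; lra.
  apply/nbhs_ballP; exists (r / (`|M| + 1)) => /=; first by rewrite divr_gt0.
  move=> y; rewrite /ball /= ltr_pdivlMr// => xy; apply: rA; rewrite /ball /=.
  have MM : M < `|M| + 1 by have := ler_norm M; lra.
  by have := hM _ MM (x, y) (conj I I) => /=; lra.
have -> : rhs gamma B eps =
    (fun s => B (s / e)) * (expR \o (fun s => (- gamma) * ln (Num.max s s0))).
  apply/funext => s; rewrite rhs_maxE /powR gt_eqF//.
  by rewrite lt_max s0_gt0 orbT.
have ci (s : R) : {for s, continuous (id : R -> R)} by exact: cvg_id.
have cc (k s : R) : {for s, continuous (cst k : R -> R)} by exact: cst_continuous.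
have h1 (s : R) : {for s, continuous (fun s : R => B (s / e))}.
  apply: (@continuous_comp R R R (fun s : R => s / e) B); last exact: cB.
  exact: (continuousM (ci s) (cc e^-1 s)).
have h2 (s : R) : {for s, continuous (fun s : R => ln (Num.max s s0))}.
  apply: (@continuous_comp R R R (fun s : R => Num.max s s0) (@ln R)).
    exact: (continuous_max (ci s) (cc s0 s)).
  by apply: continuous_ln; rewrite lt_max s0_gt0 orbT.
have h3 (s : R) : {for s, continuous (fun s : R => - gamma * ln (Num.max s s0))}.
  exact: (continuousM (cc (- gamma) s) (h2 s)).
have h4 (s : R) : {for s, continuous (expR \o (fun s : R => - gamma * ln (Num.max s s0)))}.
  by apply: continuous_comp; [exact: h3|exact: continuous_expR].
by move=> s; exact: (continuousM (h1 s) (h4 s)).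
Qed.

Lemma rhs_ge0 s : 0 <= rhs gamma B eps s.
Proof.
case: hB => _ B01 _ _; rewrite rhs_maxE mulr_ge0 ?powR_ge0//.
by have /andP[] := B01 (s / e).
Qed.

Lemma rhs_bound_ge0 : 0 <= rhs_bound gamma eps.
Proof. by rewrite mulr_ge0// powR_ge0. Qed.

Lemma rhs_le_bound s : rhs gamma B eps s <= rhs_bound gamma eps.
Proof.
case: hB => _ B01 _ _; case/andP: (hgamma) => g0 _; rewrite rhs_maxE.
apply: (@le_trans _ _ (Num.max s s0 `^ (- gamma))).
  by rewrite ler_piMl ?powR_ge0//; have /andP[] := B01 (s / e).
have ms : s0 <= Num.max s s0 by rewrite le_max lexx orbT.
rewrite (_ : rhs_bound gamma eps = s0 `^ (- gamma)); last first.
  rewrite /rhs_bound /s0 [RHS]powRM ?(ltW e_gt0) ?divr_ge0 ?(ltW delta_gt0)//.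
  by rewrite /e -powRrM mulrN.
rewrite !powRN lef_pV2 ?posrE ?powR_gt0//; last exact: lt_le_trans ms.
by rewrite ge0_ler_powR// nnegrE ltW// (lt_le_trans s0_gt0).
Qed.

Lemma rhs_neg s : s <= 0 -> rhs gamma B eps s = 0.
Proof. by move=> s_le0; rewrite /rhs -/e -/s0 ifT// (le_trans s_le0)// ltW. Qed.
End Rhs.

Lemma locally_lipschitz_enorm d (A : set 'rV[R]_d) (f : 'rV[R]_d -> R) (r a : R) :
  0 < r -> 0 <= a ->
  (forall x y, A x -> A y -> enorm (y - x) <= r -> f y <= f x + a * enorm (y - x)) ->
  locally_lipschitz_in A f.
Proof.
move=> r0 a0 fa x Ax; exists [set y | enorm (y - x) < r / 2].
  by apply/nbhs_enormP; exists (r / 2) => //; rewrite divr_gt0.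
apply: (@klipschitzW _ _ _ (a * d%:R)).
  apply: (@globally_properfilter _ _ (x, x)).
  by split => //=; split => //; rewrite /= subrr enorm0 divr_gt0.
move=> [y z] /= [[yx Ay] [zx Az]].
have yz : enorm (y - z) <= r.
  by have := enorm_triangle y x z; rewrite (enormB x z); lra.
have zy : enorm (z - y) <= r by rewrite enormB.
have := fa z y Az Ay yz; have := fa y z Ay Az zy; rewrite (enormB z y).
have := ler_wpM2l a0 (enorm_le_norm (y - z)); rewrite ler_norml mulrA.
by move=> ? ? ?; apply/andP; split; lra.
Qed.

(* The one-sided estimate holds at each [x] in [A] with the same radius and
   constant; together with the sup bound it makes [f] globally Lipschitz on [A],
   so a Lipschitz extension reduces the claim to Rademacher's theorem. *)
Lemma ae_differentiable_lipschitz d (A : set 'rV[R]_d) (f : 'rV[R]_d -> R) (r a M : R) :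
  open A -> 0 < r -> 0 <= a -> (forall x, A x -> 0 <= f x <= M) ->
  (forall x y, A x -> enorm (y - x) <= r -> f y <= f x + a * enorm (y - x)) ->
  ae_in A (fun x => differentiable f x /\ enorm (grad f x) <= a).
Proof.
move=> oA r0 a0 fM fa.
have [A0|A0] := pselect (A !=set0); last first.
  by apply: leb_nullS (@leb_null0 R d) => x [Ax _]; apply: A0; exists x.
have M0 : 0 <= M by case: A0 => x /fM/andP[? ?]; lra.
have Mr : 0 <= M / r by rewrite divr_ge0// ltW.
have K0 : 0 <= (a + M / r) * d%:R by rewrite mulr_ge0// addr_ge0.
have [g gf gL] : exists2 g : 'rV[R]_d -> R, forall x, A x -> g x = f x &
    forall x y, `|g x - g y| <= (a + M / r) * d%:R * `|x - y|.
  apply: mcshane => // x y Ax Ay.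
  have h1 := ler_wpM2l (addr_ge0 a0 Mr) (enorm_le_norm (x - y)); rewrite mulrA in h1.
  have h0 := enorm_ge0 (x - y).
  have [xy|xy] := leP (enorm (x - y)) r.
    have := fa y x Ay xy; have : 0 <= M / r * enorm (x - y) by rewrite mulr_ge0.
    by move: h1; rewrite mulrDl; lra.
  have /andP[? ?] := fM x Ax; have /andP[? ?] := fM y Ay.
  have : M <= M / r * enorm (x - y).
    by rewrite mulrAC ler_pdivlMr// ler_wpM2l// ltW.
  have : 0 <= a * enorm (x - y) by rewrite mulr_ge0.
  by move: h1; rewrite mulrDl; lra.
apply: leb_nullS (rademacher gL) => x [Ax nd] /= gx; apply: nd.
have nA : \forall y \near x, A y by exact: open_nbhs_nbhs.
have df : differentiable f x.
  apply: differentiable_approx; apply: first_order_approx_local gx.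
  by apply: filterS nA => y; exact: gf.
split => //; apply: enorm_grad_le => //.
by apply/nbhs_enormP; exists r => // y yx; apply: fa => //; exact: ltW.
Qed.
End Final.

Theorem theorem4 (R : realType) (n : nat) (gamma : R) (hgamma : 0 <= gamma < 1)
  (B : R -> R) (hB : admissible_B gamma B)
  (Omega : set 'rV[R]_n.+1) (hOmega : bounded_smooth_domain Omega)
  (phi : 'rV[R]_n.+1 -> R) (hphi : W2inf_boundary Omega phi)
  (hphi0 : forall x, boundary Omega x -> 0 <= phi x)
  (ulow : R -> 'rV[R]_n.+1 -> R)
  (hulow : forall eps : R, 0 < eps ->
     visc_solution Omega (fun _ => rhs_bound gamma eps) phi (ulow eps))
  (uup : 'rV[R]_n.+1 -> R)
  (huup : visc_solution Omega (fun _ => 0) phi uup) :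
  exists u : R -> 'rV[R]_n.+1 -> R,
    [/\ forall eps : R, 0 < eps ->
          minimal_visc_solution Omega (rhs gamma B eps) phi (ulow eps) uup
            (u eps),
        forall Omega' : set 'rV[R]_n.+1,
          open Omega' -> compact (closure Omega') -> closure Omega' `<=` Omega ->
          exists L : R, forall eps : R, 0 < eps ->
            locally_lipschitz_in Omega' (u eps) /\
            ae_in Omega' (fun x =>
              differentiable (u eps) x /\ enorm (grad (u eps) x) <= L)
      & forall eps : R, 0 < eps -> forall x, closure Omega x ->
          0 <= u eps x <= boundary_sup_norm Omega phi].
Proof.
have [oO _ [x0 Ox0] bO _] := hOmega; have [cup subup superup bup] := huup.
have clO : Omega `<=` closure Omega := @subset_closure _ Omega.
have low_up eps : 0 < eps -> forall x, closure Omega x -> ulow eps x <= uup x.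
  move=> eps0 x clx; have [clow sublow _ blow] := hulow eps eps0.
  (* As [rhs_bound] is nonnegative, [ulow] is infinity-subharmonic, and so is [- uup]. *)
  rewrite -subr_le0; apply: (@radial_sub_comparison R n Omega (ulow eps) (fun y => - uup y)) => //.
  - by apply: visc_sub_radial sublow => y _; rewrite oppr0; exact: rhs_bound_ge0.
  - by apply: visc_super_radial superup.
  - by move=> y; exact: (continuousN (cup y)).
  - by move=> y By; rewrite blow// bup// subrr.
pose u eps := perron_inf Omega (rhs gamma B eps) (ulow eps) uup.
have umin eps : 0 < eps ->
    minimal_visc_solution Omega (rhs gamma B eps) phi (ulow eps) uup (u eps).
  move=> eps0; apply: (@perron_inf_minimal _ _ _ _ (rhs_bound gamma eps)) => //.
  - exact: rhs_continuous.
  - by move=> s; exact: rhs_ge0.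
  - by move=> s; exact: rhs_le_bound.
  - exact: hulow.
  - exact: low_up.
have bounds eps : 0 < eps -> forall x, closure Omega x ->
    0 <= u eps x <= boundary_sup_norm Omega phi.
  move=> eps0 x clx; have [_ [cu _ superu bu]] := umin eps eps0; apply/andP; split.
    (* Where [u eps] is negative the right-hand side vanishes, so [- u eps] is infinity-subharmonic
       there; this is the region in which the maximum principle tests it. *)
    rewrite -oppr_le0.
    apply: (@radial_max_principle R n Omega (fun y => - u eps y)) => //.
    - by move=> y; exact: (continuousN (cu y)).
    - apply: visc_super_radial superu; first by move=> y [].
      by move=> y [_ /=]; rewrite oppr_gt0 => uy; rewrite rhs_neg// ltW.
    - by move=> y By; rewrite oppr_le0 bu// hphi0.
  apply: (@le_trans _ _ (uup x)).
    apply: perron_inf_up => //.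
    - by move=> s; exact: rhs_ge0.
    - exact: low_up.
  have [M M0 hM] := compact_bounded_fun (bounded_closure_compact bO) cup.
  apply: (@radial_max_principle R n Omega uup) => //.
  - have : radial_sub Omega 0 uup by apply: visc_sub_radial subup => y _; rewrite oppr0.
    by move=> h z c0 c1 c2 y [Oy _]; exact: h.
  - move=> y By; rewrite bup//; apply: (le_trans (ler_norm _)).
    apply: ub_le_sup; last by exists y.
    exists M => _ [z Bz <-]; rewrite -bup//; apply: hM; by case: Bz.
exists u; split => // Omega' oO' cO' O'O.
have [r r0 hr] := compact_margin cO' oO O'O.
pose M := boundary_sup_norm Omega phi.
have M0 : 0 <= M.
  by have /andP[u0 uM] := bounds 1 ltr01 x0 (clO _ Ox0); exact: le_trans u0 uM.
(* The constant comes from the bound 0, the boundary sup norm and the margin of [Omega']; none of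
   them involves [eps]. *)
have [a a0 ha] := @radial_sub_lipschitz R n.+1 0 M r (lexx _) M0 r0.
exists a => eps eps0; have [_ [cu subu _ _]] := umin eps eps0.
have su : radial_sub Omega 0 (u eps).
  by apply: visc_sub_radial subu => y _; rewrite oppr0; exact: rhs_ge0.
have ua x y : Omega' x -> enorm (y - x) <= r -> u eps y <= u eps x + a * enorm (y - x).
  move=> Ox yx; have BO z : enorm (z - x) <= r -> Omega z.
    by apply: hr; exact: subset_closure.
  apply: (ha Omega) => //.
    by apply: within_sub cu => z /BO/clO.
  by move=> z /BO/clO/(bounds eps eps0)/andP[? ?]; rewrite ger0_norm.
split.
  by apply: (locally_lipschitz_enorm r0 (ltW a0)) => x y Ox _; exact: ua.
apply: (@ae_differentiable_lipschitz _ _ _ _ r a M) => //; first exact: ltW.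
by move=> x /subset_closure/O'O/clO; exact: bounds.
Qed.
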